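(* Let $k_0$ be any field and $i$ an integer $\geq 2$. Write $\tau_i:K^M_*(k_0)\to K^M_*(k_0)$ for the homomorphism $x\mapsto\{-1\}^{i-1}\cdot x$. \begin{itemize} \item If $i$ is even, the algebra of operations $K^M_i(k)\to K^M_*(k)$ over $k_0$ commuting with specialization maps is the $K^M_*(k_0)$-module $$K^M_*(k_0)\oplus K^M_*(k_0)\cdot\mathrm{id}\oplus\bigoplus_{n\geq 2}\mathrm{Ker}(\tau_i)\cdot\gamma_n.$$ \item If $i$ is odd, the algebra of operations $K^M_i(k)\to K^M_*(k)$ over $k_0$ commuting with specialization maps is the $K^M_*(k_0)$-module $$K^M_*(k_0)\oplus K^M_*(k_0)\cdot\mathrm{id}\oplus\bigoplus_{n\geq 2}{}_2\mathrm{Ker}(\tau_i)\cdot\gamma_n.$$ \end{itemize}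
   Context: $K^M_*(k)=\bigoplus_{n\ge0}K^M_n(k)$ is the (integral) Milnor $K$-ring of the field $k$, generated by symbols $\{a_1,\ldots,a_n\}\in K^M_n(k)$. An operation $\varphi:K^M_i\to K^M_*$ over $k_0$ is a natural transformation on the category of field extensions of $k_0$: a family of functions (not assumed additive) $K^M_i(k)\to K^M_*(k)$, one for each field extension $k/k_0$, compatible with field extensions over $k_0$. Operations are added and multiplied pointwise and form a module over $K^M_*(k_0)$ via $(a\cdot\varphi)(x)=a_k\cdot\varphi(x)$, where $a_k$ is the image of $a$ in $K^M_*(k)$. Specialization: let $K$ be a field with discrete valuation $v$, residue field $\kappa$ and uniformizer $\pi$. There is a unique homomorphism $s_\pi:K^M_n(K)\to K^M_n(\kappa)$ with $s_\pi(\{\pi^{i_1}u_1,\ldots,\pi^{i_n}u_n\})=\{\bar u_1,\ldots,\bar u_n\}$ for units $u_r$ of the valuation ring. An operation $\varphi$ over $k_0$ commutes with specialization maps if for every extension $K/k_0$ with a discrete valuation $v$ whose valuation ring contains $k_0$ (so $\kappa\supseteq k_0$) and every uniformizer $\pi$, one has $s_\pi\circ\varphi=\varphi\circ s_\pi$ on $K^M_i(K)$. The first summand $K^M_*(k_0)$ consists of the constant operations $x\mapsto y_0$, and $K^M_*(k_0)\cdot\mathrm{id}$ of the operations $x\mapsto y_1\cdot x$. ${}_2\mathrm{Ker}(\tau_i)=\{y\in\mathrm{Ker}(\tau_i): 2y=0\}$. For $y_n$ in $\mathrm{Ker}(\tau_i)$ ($i$ even), resp. ${}_2\mathrm{Ker}(\tau_i)$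 ($i$ odd), $y_n\cdot\gamma_n$ is the operation sending a sum of symbols $s_1+\cdots+s_l\in K^M_i(k)$ to $y_n\cdot\sum_{l_1<\cdots<l_n}s_{l_1}\cdots s_{l_n}$; this is independent of the decomposition into symbols.
   Formalization: The direct sum is claimed for operations of bounded degree only; arbitrary operations commuting with specialization are the unique pointwise finite, possibly infinite, sums with the same coefficients (over F_2, i=2, the sum of all γ_n is an operation outside the direct sum). *)

(* Defs.v *)
From HB Require Import structures.
From mathcomp Require Import all_boot all_order all_algebra.
From mathcomp Require Import boolp classical_sets.

Set Implicit Arguments.
Unset Strict Implicit.
Unset Printing Implicit Defensive.

Import GRing.Theory Num.Theory.

Local Open Scope quotient_scope.
Local Open Scope classical_set_scope.
Local Open Scope ring_scope.

(* Milnor's presentation: K^M_*(F) is the free associative ring on symbols {a},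
   a in F^*, modulo {ab} = {a} + {b} and {a}{1-a} = 0. The free ring is
   presented by ring terms; [milnor_eq] is the congruence generated by the ring
   axioms and these relations. A symbol is allowed for a = 0, with the
   convention {0} = 0 (= {1}): this adds no element and no relation. *)
Inductive mterm (F : Type) : Type :=
| MSym of F
| MZero
| MOne
| MOpp of mterm F
| MAdd of mterm F & mterm F
| MMul of mterm F & mterm F.
Arguments MZero {F}.
Arguments MOne {F}.

Inductive milnor_eq (F : fieldType) : mterm F -> mterm F -> Prop :=
| meq_refl x : milnor_eq x x
| meq_sym x y : milnor_eq x y -> milnor_eq y x
| meq_trans y x z : milnor_eq x y -> milnor_eq y z -> milnor_eq x z
| meq_opp x x' : milnor_eq x x' -> milnor_eq (MOpp x) (MOpp x')
| meq_add x x' y y' : milnor_eq x x' -> milnor_eq y y' ->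
    milnor_eq (MAdd x y) (MAdd x' y')
| meq_mul x x' y y' : milnor_eq x x' -> milnor_eq y y' ->
    milnor_eq (MMul x y) (MMul x' y')
| meq_addA x y z : milnor_eq (MAdd x (MAdd y z)) (MAdd (MAdd x y) z)
| meq_addC x y : milnor_eq (MAdd x y) (MAdd y x)
| meq_add0 x : milnor_eq (MAdd MZero x) x
| meq_addN x : milnor_eq (MAdd (MOpp x) x) MZero
| meq_mulA x y z : milnor_eq (MMul x (MMul y z)) (MMul (MMul x y) z)
| meq_mul1l x : milnor_eq (MMul MOne x) x
| meq_mul1r x : milnor_eq (MMul x MOne) x
| meq_mulDl x y z : milnor_eq (MMul (MAdd x y) z) (MAdd (MMul x z) (MMul y z))
| meq_mulDr x y z : milnor_eq (MMul x (MAdd y z)) (MAdd (MMul x y) (MMul x z))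
| meq_symM (a b : F) : a != 0 -> b != 0 ->
    milnor_eq (MSym (a * b)) (MAdd (MSym a) (MSym b))
| meq_steinberg (a : F) : a != 0 -> a != 1 ->
    milnor_eq (MMul (MSym a) (MSym (1 - a))) MZero
| meq_sym0 : milnor_eq (MSym 0) MZero.

HB.instance Definition _ (F : Type) := gen_eqMixin (mterm F).
HB.instance Definition _ (F : Type) := gen_choiceMixin (mterm F).

Section MilnorRing.
Variable F : fieldType.

Definition milnor_eqb : rel (mterm F) := fun x y => `[< milnor_eq x y >].

Lemma milnor_eqb_refl : reflexive milnor_eqb.
Proof. by move=> x; apply/asboolP/meq_refl. Qed.
Lemma milnor_eqb_sym : symmetric milnor_eqb.
Proof. by move=> x y; apply/asboolP/asboolP; apply: meq_sym. Qed.
Lemma milnor_eqb_trans : transitive milnor_eqb.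
Proof. by move=> y x z /asboolP ? /asboolP ?; apply/asboolP/(meq_trans (y := y)). Qed.

Canonical milnor_equiv :=
  EquivRel milnor_eqb milnor_eqb_refl milnor_eqb_sym milnor_eqb_trans.

Definition milnorK : Type := {eq_quot milnor_equiv}.
HB.instance Definition _ := Choice.on milnorK.

Definition mpi (x : mterm F) : milnorK := \pi_({eq_quot milnor_equiv}) x.
Definition mrepr (x : milnorK) : mterm F := repr (x : {eq_quot milnor_equiv}).

Lemma mreprK : cancel mrepr mpi.
Proof. exact: reprK. Qed.

Lemma mpi_eq (x y : mterm F) : mpi x = mpi y <-> milnor_eq x y.
Proof.
split; first by move/eqmodP => /asboolP.
by move=> ?; apply/eqmodP/asboolP.
Qed.

Lemma mrepr_pi x : milnor_eq (mrepr (mpi x)) x.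
Proof. by apply/mpi_eq; rewrite mreprK. Qed.

Definition madd (x y : milnorK) := mpi (MAdd (mrepr x) (mrepr y)).
Definition mopp (x : milnorK) := mpi (MOpp (mrepr x)).
Definition mmul (x y : milnorK) := mpi (MMul (mrepr x) (mrepr y)).

Lemma maddE x y : madd (mpi x) (mpi y) = mpi (MAdd x y).
Proof. by apply/mpi_eq/meq_add; apply: mrepr_pi. Qed.
Lemma moppE x : mopp (mpi x) = mpi (MOpp x).
Proof. by apply/mpi_eq/meq_opp; apply: mrepr_pi. Qed.
Lemma mmulE x y : mmul (mpi x) (mpi y) = mpi (MMul x y).
Proof. by apply/mpi_eq/meq_mul; apply: mrepr_pi. Qed.

Lemma mpiP (x : milnorK) : exists t, x = mpi t.
Proof. by exists (mrepr x); rewrite mreprK. Qed.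

Lemma maddA : associative madd.
Proof.
move=> x y z; case: (mpiP x) (mpiP y) (mpiP z) => [r ->] [s ->] [t ->].
by rewrite !maddE; apply/mpi_eq/meq_addA.
Qed.
Lemma maddC : commutative madd.
Proof.
move=> x y; case: (mpiP x) (mpiP y) => [r ->] [s ->].
by rewrite !maddE; apply/mpi_eq/meq_addC.
Qed.
Lemma madd0 : left_id (mpi MZero) madd.
Proof. by move=> x; case: (mpiP x) => r ->; rewrite maddE; apply/mpi_eq/meq_add0. Qed.
Lemma maddN : left_inverse (mpi MZero) mopp madd.
Proof.
by move=> x; case: (mpiP x) => r ->; rewrite moppE maddE; apply/mpi_eq/meq_addN.
Qed.

HB.instance Definition _ := GRing.isZmodule.Build milnorK maddA maddC madd0 maddN.

Lemma mmulA : associative mmul.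
Proof.
move=> x y z; case: (mpiP x) (mpiP y) (mpiP z) => [r ->] [s ->] [t ->].
by rewrite !mmulE; apply/mpi_eq/meq_mulA.
Qed.
Lemma mmul1l : left_id (mpi MOne) mmul.
Proof. by move=> x; case: (mpiP x) => r ->; rewrite mmulE; apply/mpi_eq/meq_mul1l. Qed.
Lemma mmul1r : right_id (mpi MOne) mmul.
Proof. by move=> x; case: (mpiP x) => r ->; rewrite mmulE; apply/mpi_eq/meq_mul1r. Qed.
Lemma mmulDl : left_distributive mmul madd.
Proof.
move=> x y z; case: (mpiP x) (mpiP y) (mpiP z) => [r ->] [s ->] [t ->].
by rewrite !(maddE, mmulE); apply/mpi_eq/meq_mulDl.
Qed.
Lemma mmulDr : right_distributive mmul madd.
Proof.
move=> x y z; case: (mpiP x) (mpiP y) (mpiP z) => [r ->] [s ->] [t ->].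
by rewrite !(maddE, mmulE); apply/mpi_eq/meq_mulDr.
Qed.

HB.instance Definition _ :=
  GRing.Zmodule_isPzRing.Build milnorK mmulA mmul1l mmul1r mmulDl mmulDr.

Definition sym1 (a : F) : milnorK := mpi (MSym a).

(* {a_1, ..., a_n} *)
Definition symbol (s : seq F) : milnorK := \prod_(a <- s) sym1 a.

Lemma mpi0 : mpi MZero = 0. Proof. by []. Qed.
Lemma mpi1 : mpi MOne = 1. Proof. by []. Qed.
Lemma mpiN x : mpi (MOpp x) = - mpi x. Proof. by rewrite -moppE. Qed.
Lemma mpiD x y : mpi (MAdd x y) = mpi x + mpi y. Proof. by rewrite -maddE. Qed.
Lemma mpiM x y : mpi (MMul x y) = mpi x * mpi y. Proof. by rewrite -mmulE. Qed.

Lemma sym1_0 : sym1 0 = 0. Proof. by apply/mpi_eq/meq_sym0. Qed.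
Lemma sym1M a b : a != 0 -> b != 0 -> sym1 (a * b) = sym1 a + sym1 b.
Proof. by move=> a0 b0; rewrite -mpiD; apply/mpi_eq/meq_symM. Qed.
Lemma sym1_steinberg a : a != 0 -> a != 1 -> sym1 a * sym1 (1 - a) = 0.
Proof. by move=> a0 b0; rewrite -mpiM; apply/mpi_eq/meq_steinberg. Qed.

(* K^M_n(F), the degree n part, as a subgroup of K^M_*(F); the integer
   multiplicities only matter for n = 0. *)
Definition milnor_deg (n : nat) : {pred milnorK} := fun x =>
  `[< exists s : seq (int * n.-tuple F), x = \sum_(p <- s) symbol p.2 *~ p.1 >].

Lemma milnor_deg_zmod n : zmod_closed (milnor_deg n).
Proof.
split; first by apply/asboolP; exists [::]; rewrite big_nil.
move=> x y /asboolP[s ->] /asboolP[t ->]; apply/asboolP.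
exists (s ++ [seq (- p.1, p.2) | p <- t]).
rewrite big_cat big_map /= -sumrN; congr (_ + _).
by apply: eq_bigr => p _; rewrite mulrNz.
Qed.

HB.instance Definition _ n :=
  GRing.isZmodClosed.Build milnorK (milnor_deg n) (milnor_deg_zmod n).

Definition milnorKn (n : nat) : Type := {x : milnorK | x \in milnor_deg n}.
HB.instance Definition _ n := SubChoice.on (milnorKn n).
HB.instance Definition _ n := [SubChoice_isSubZmodule of milnorKn n by <:].

End MilnorRing.

Fixpoint mterm_map (F L : Type) (f : F -> L) (t : mterm F) : mterm L :=
  match t with
  | MSym a => MSym (f a)
  | MZero => MZero
  | MOne => MOne
  | MOpp x => MOpp (mterm_map f x)
  | MAdd x y => MAdd (mterm_map f x) (mterm_map f y)
  | MMul x y => MMul (mterm_map f x) (mterm_map f y)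
  end.

Section Functoriality.
Variables (F L : fieldType) (f : {rmorphism F -> L}).

Lemma mterm_map_eq x y :
  milnor_eq x y -> milnor_eq (mterm_map f x) (mterm_map f y).
Proof.
elim=> /=; try by constructor.
- by move=> y' x' z _ h1 _ h2; apply: meq_trans h1 h2.
- by move=> a b a0 b0; rewrite rmorphM; apply: meq_symM; rewrite fmorph_eq0.
- move=> a a0 a1; rewrite rmorphB rmorph1; apply: meq_steinberg.
    by rewrite fmorph_eq0.
  by rewrite fmorph_eq1.
- by rewrite rmorph0; apply: meq_sym0.
Qed.

Definition milnor_map (x : milnorK F) : milnorK L := mpi (mterm_map f (mrepr x)).

Lemma milnor_map_pi t : milnor_map (mpi t) = mpi (mterm_map f t).
Proof. exact/mpi_eq/mterm_map_eq/mrepr_pi. Qed.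

Lemma milnor_map_is_zmod_morphism : zmod_morphism milnor_map.
Proof.
move=> x y; case: (mpiP x) (mpiP y) => [r ->] [s ->].
by rewrite -mpiN -mpiD !milnor_map_pi /= mpiD mpiN.
Qed.
Lemma milnor_map_is_monoid_morphism : monoid_morphism milnor_map.
Proof.
split; first by rewrite -mpi1 milnor_map_pi.
move=> x y; case: (mpiP x) (mpiP y) => [r ->] [s ->].
by rewrite -mpiM !milnor_map_pi /= mpiM.
Qed.
HB.instance Definition _ :=
  GRing.isZmodMorphism.Build (milnorK F) (milnorK L) milnor_map
    milnor_map_is_zmod_morphism.
HB.instance Definition _ :=
  GRing.isMonoidMorphism.Build (milnorK F) (milnorK L) milnor_map
    milnor_map_is_monoid_morphism.

Lemma milnor_map_sym1 a : milnor_map (sym1 a) = sym1 (f a).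
Proof. exact: milnor_map_pi. Qed.
Lemma milnor_map_symbol s : milnor_map (symbol s) = symbol (map f s).
Proof.
rewrite /symbol rmorph_prod big_map.
by apply: eq_bigr => a _; apply: milnor_map_sym1.
Qed.

Lemma milnor_map_deg n (x : milnorKn F n) :
  milnor_map (val x) \in @milnor_deg L n.
Proof.
case: x => x /= /asboolP[s ->]; apply/asboolP.
exists [seq (p.1, map_tuple f p.2) | p <- s].
rewrite big_map raddf_sum; apply: eq_bigr => p _ /=.
by rewrite raddfMz -milnor_map_symbol.
Qed.

Definition milnor_mapn n (x : milnorKn F n) : milnorKn L n :=
  Sub (milnor_map (val x)) (milnor_map_deg x).

End Functoriality.

(* [v] is only meaningful on nonzero elements; it is normalized. *)
Record discrete_valuation (K : fieldType) (v : K -> int) : Prop := {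
  dval_mul : forall x y, x != 0 -> y != 0 -> v (x * y) = v x + v y;
  dval_add : forall x y, x != 0 -> y != 0 -> x + y != 0 ->
    Num.min (v x) (v y) <= v (x + y);
  dval_surj : exists2 x, x != 0 & v x = 1
}.

Definition valuation_ring (K : fieldType) (v : K -> int) : set K :=
  [set x | x = 0 \/ 0 <= v x].

(* [res] exhibits [kappa] as the quotient of the valuation ring of [v] by its
   maximal ideal; the values of [res] outside the valuation ring are junk. *)
Record residue_field (K : fieldType) (v : K -> int)
    (kappa : fieldType) (res : K -> kappa) : Prop := {
  res_1 : res 1 = 1;
  res_add : forall x y, valuation_ring v x -> valuation_ring v y ->
    res (x + y) = res x + res y;
  res_mul : forall x y, valuation_ring v x -> valuation_ring v y ->
    res (x * y) = res x * res y;
  res_surj : forall c, exists2 x, valuation_ring v x & res x = c;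
  res_ker : forall x, valuation_ring v x ->
    (res x = 0 <-> x = 0 \/ 0 < v x)
}.

Definition uniformizer (K : fieldType) (v : K -> int) (p : K) : Prop :=
  p != 0 /\ v p = 1.

(* The specialization map s_p, in all degrees at once: the (unique) additive map
   with s_p {p^i1 u1, ..., p^in un} = {res u1, ..., res un}; the entries of [s]
   are the pairs (i_r, u_r). *)
Definition is_specialization (K kappa : fieldType) (v : K -> int)
    (res : K -> kappa) (p : K) (sp : {additive milnorK K -> milnorK kappa}) : Prop :=
  forall s : seq (int * K),
    (forall e, e \in s -> e.2 != 0 /\ v e.2 = 0) ->
    sp (symbol [seq p ^ e.1 * e.2 | e <- s]) = symbol [seq res e.2 | e <- s].

Section Specialization.
Variables (K kappa : fieldType) (v : K -> int) (res : K -> kappa) (p : K).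
Variable sp : {additive milnorK K -> milnorK kappa}.
Hypotheses (hv : discrete_valuation v) (hp : uniformizer v p).
Hypothesis hsp : is_specialization v res p sp.

Lemma dval1 : v 1 = 0.
Proof.
by apply: (addrI (v 1)); rewrite -(dval_mul hv) ?oner_neq0// mulr1 addr0.
Qed.

Lemma dvalV x : x != 0 -> v x^-1 = - v x.
Proof.
move=> x0; apply: (addrI (v x)).
by rewrite -(dval_mul hv) ?invr_eq0// divff// dval1 subrr.
Qed.

Lemma dvalX n : v (p ^+ n) = n%:Z.
Proof.
case: hp => p0 vp; elim: n => [|n IH]; first by rewrite expr0 dval1.
by rewrite exprS (dval_mul hv) ?expf_neq0// IH vp -intS.
Qed.

Lemma dvalXz (n : int) : v (p ^ n) = n.
Proof.
case: n => n; first exact: dvalX.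
by rewrite NegzE -exprnN dvalV ?dvalX// expf_neq0//; case: hp.
Qed.

Lemma specialization_deg n (x : milnorKn K n) :
  sp (val x) \in @milnor_deg kappa n.
Proof.
case: x => x /= /asboolP[s ->].
rewrite raddf_sum rpred_sum// => -[m t] _ /=; rewrite raddfMz rpredMz//.
have [t0|t0] := boolP (0 \in (t : seq K)).
  suff -> : symbol t = 0 by rewrite raddf0 rpred0.
  rewrite /symbol; elim: (t : seq K) t0 => //= a l IH.
  rewrite inE big_cons => /orP[/eqP <-|/IH ->]; last by rewrite mulr0.
  by rewrite sym1_0 mul0r.
have p0 : p != 0 by case: hp.
have tE : (t : seq K) =
    [seq p ^ e.1 * e.2 | e <- [seq (v a, a / p ^ v a) | a <- t]].
  rewrite -map_comp -[LHS]map_id; apply: eq_map => a /=.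
  by rewrite mulrC divfK// expfz_neq0.
rewrite tE hsp; last first.
  move=> e /mapP[a at_ ->] /=.
  have a0 : a != 0 by apply: contraNneq t0 => <-.
  split; first by rewrite mulf_neq0// invr_eq0 expfz_neq0.
  by rewrite (dval_mul hv) ?invr_eq0 ?expfz_neq0// dvalV ?expfz_neq0// dvalXz subrr.
rewrite -map_comp; apply/asboolP.
exists [:: (1, map_tuple (fun a => res (a / p ^ v a)) t)].
by rewrite big_seq1 /= mulr1z.
Qed.

Definition specializationn n (x : milnorKn K n) : milnorKn kappa n :=
  Sub (sp (val x)) (specialization_deg x).

End Specialization.

Definition op_family (k0 : fieldType) (i : nat) : Type :=
  forall (k : fieldType) (iota : {rmorphism k0 -> k}), milnorKn k i -> milnorK k.

Definition is_operation (k0 : fieldType) (i : nat) (phi : op_family k0 i) : Prop :=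
  forall (k l : fieldType) (iota : {rmorphism k0 -> k})
    (iota' : {rmorphism k0 -> l}) (f : {rmorphism k -> l}),
  (forall a, f (iota a) = iota' a) ->
  forall x : milnorKn k i,
    milnor_map f (phi k iota x) = phi l iota' (milnor_mapn f x).

(* The extension k0 -> kappa is the one induced by k0 -> valuation ring. *)
Definition commutes_with_specialization (k0 : fieldType) (i : nat)
    (phi : op_family k0 i) : Prop :=
  forall (K : fieldType) (iota : {rmorphism k0 -> K}) (v : K -> int)
    (hv : discrete_valuation v),
  (forall a, valuation_ring v (iota a)) ->
  forall (kappa : fieldType) (res : K -> kappa),
  residue_field v res ->
  forall iotaK : {rmorphism k0 -> kappa},
  (forall a, iotaK a = res (iota a)) ->
  forall (p : K) (hp : uniformizer v p)
    (sp : {additive milnorK K -> milnorK kappa})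
    (hsp : is_specialization v res p sp),
  forall x : milnorKn K i,
    sp (phi K iota x) = phi kappa iotaK (specializationn hv hp hsp x).

(* [phi] takes values in the sum of the K^M_j, j < N, for some N independent of
   the extension: the operations of bounded degree form
   \bigoplus_j Op(K^M_i, K^M_j). A general operation need not be bounded: over
   F_2, s_1 + ... + s_l |-> (1 + s_1) ... (1 + s_l) is an operation on K^M_2. *)
Definition bounded_degree (k0 : fieldType) (i : nat) (phi : op_family k0 i) : Prop :=
  exists N : nat, forall (k : fieldType) (iota : {rmorphism k0 -> k}) (x : milnorKn k i),
    exists c : forall j, milnorKn k j, phi k iota x = \sum_(j < N) val (c j).

Definition op_const (k0 : fieldType) (i : nat) (y : milnorK k0) : op_family k0 i :=
  fun k iota x => milnor_map iota y.

Definition op_scale (k0 : fieldType) (i : nat) (y : milnorK k0)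
    (phi : op_family k0 i) : op_family k0 i :=
  fun k iota x => milnor_map iota y * phi k iota x.

Definition op_id (k0 : fieldType) (i : nat) : op_family k0 i :=
  fun k iota x => val x.

(* \sum_(l_1 < ... < l_n) s_(l_1) ... s_(l_n): the enumeration of ordinals is
   increasing, so each (noncommutative) product is in the intended order. *)
Definition elem_sym (R : pzRingType) (n : nat) (s : seq R) : R :=
  \sum_(A : {set 'I_(size s)} | #|A| == n) \prod_(j in A) s`_j.

Definition is_symbol_sum (k : fieldType) (i : nat) (x : milnorKn k i)
    (s : seq (i.-tuple k)) : Prop :=
  val x = \sum_(a <- s) symbol a.

(* A decomposition of [x] into symbols (one exists as soon as i > 0). *)
Definition symbol_decomp (k : fieldType) (i : nat) (x : milnorKn k i) :
    seq (i.-tuple k) :=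
  xget [::] [set s | is_symbol_sum x s].

(* y . gamma_n, through the chosen decomposition. *)
Definition op_gamma (k0 : fieldType) (i n : nat) (y : milnorK k0) : op_family k0 i :=
  fun k iota x =>
    milnor_map iota y * elem_sym n [seq symbol a | a : i.-tuple k <- symbol_decomp x].

Definition tau (k0 : fieldType) (i : nat) (x : milnorK k0) : milnorK k0 :=
  sym1 (-1) ^+ i.-1 * x.

(* Ker(tau_i) for i even, 2-torsion of Ker(tau_i) for i odd. *)
Definition gamma_coef (k0 : fieldType) (i : nat) : set (milnorK k0) :=
  [set y | tau i y = 0 /\ (odd i -> y *+ 2 = 0)].

(* Sequences (y_0, y_1, y_2, ...) of coefficients: y_0 and y_1 are arbitrary. *)
Definition coef_family (k0 : fieldType) (i : nat) (y : nat -> milnorK k0) : Prop :=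
  forall n, (2 <= n)%N -> gamma_coef i (y n).

(* y_0 + y_1 . id + \sum_(2 <= n <= N) y_n . gamma_n *)
Definition op_sum (k0 : fieldType) (i : nat) (y : nat -> milnorK k0) (N : nat) :
    op_family k0 i :=
  fun k iota x =>
    op_const (y 0%N) iota x + op_scale (y 1%N) (@op_id k0 i) iota x
    + \sum_(2 <= n < N.+1) op_gamma n (y n) iota x.

(* [phi] is the possibly infinite, but pointwise finite, sum
   y_0 + y_1 . id + \sum_(n >= 2) y_n . gamma_n. Every such sum makes sense, as
   gamma_n vanishes on sums of fewer than n symbols. *)
Definition op_sums_to (k0 : fieldType) (i : nat) (y : nat -> milnorK k0)
    (phi : op_family k0 i) : Prop :=
  forall (k : fieldType) (iota : {rmorphism k0 -> k}) (x : milnorKn k i),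
    exists N0, forall N, (N0 <= N)%N -> phi k iota x = op_sum y N iota x.

(* Main.v *)
Require Import Defs.
From mathcomp Require Import all_boot all_order all_algebra.
From mathcomp Require Import boolp classical_sets.
From HB Require Import structures.
Import Defs.

(** Write [{a}] for the symbol of [a], and let [phi] be an operation that commutes
    with specialization maps.

    The basic point is that [phi] is affine in every entry of every symbol. Fix the
    other entries in a field [k] and let [w] be the value of [phi] when the
    remaining entry is a variable [t]; thus [w] belongs to the Milnor ring of
    [k(t)]. For the valuation at [t = 0], the uniformizer [t / a] specializes [t]
    to [a], while the uniformizer [t] specializes it to 1. Changing the uniformizer
    changes the specialization of [w] by the residue of [w] times [{a}]
    ([spec_change]). Hence the value of [phi] at [a] is its value at 1 plus
    [c {a}], where [c] is the residue of [w] at [t = 0] and does not depend on [a]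
    ([op_word_affine]).

    The slope [c] is again affine in the other entries ([word_der_affine]), so the
    [i] entries of a symbol [s] can be treated one after the other. Since [s]
    vanishes as soon as one entry is 1, only the term with all the entries
    survives, and [phi (x + s) = phi x + (D phi) x * s] where [D phi] depends on [x]
    only ([word_good_append]). Iterating over the symbols of a sum [s_1 + ... + s_l]
    yields the sum over [n] of [y_n e_n (s_1, ..., s_l)], where [y_n] is the value
    of the [n]-th iterate [D (... (D phi))] at 0 ([word_good_expansion]).

    The coefficients are constrained because the value depends on the sum only:
    the relations [{a b, p} = {a, p} + {b, p}] and [s + s' = s' + s] force, for
    [n >= 2], [{-1}^(i-1) y_n = 0] and, when [i] is odd, [2 y_n = 0]
    ([word_good_coef]). The cancellation of generic symbols used here
    ([milnor_generic_inj]) also proves that the coefficients are unique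
    ([op_sum_eq0]).

    Conversely, under these constraints [y_n e_n (s_1, ..., s_l)] depends only on
    [s_1 + ... + s_l] ([esym_coef_indep]). It suffices to follow it along the
    defining relations of the group of sums of symbols, and that the Milnor ring
    has no other relations in a given degree is proved by letting it act on
    multilinear functions of words ([multilinear_lift]). Such sums commute with
    specialization maps because these are multiplicative. *)

Set Implicit Arguments.
Unset Strict Implicit.
Unset Printing Implicit Defensive.

Import Order.TTheory GRing.Theory Num.Theory.
Local Open Scope quotient_scope.
Local Open Scope ring_scope.

(** * Maps out of the Milnor ring *)

(** The functions on [F] that extend to the Milnor ring of [F]. The condition at
    0 reflects the convention [{0} = 0] of the presentation. *)
Record steinberg_map (F : fieldType) (R : pzRingType) := SteinbergMap {
  steinberg_fun :> F -> R;
  steinberg_map0 : steinberg_fun 0 = 0;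
  steinberg_mapM : forall a b, a != 0 -> b != 0 ->
    steinberg_fun (a * b) = steinberg_fun a + steinberg_fun b;
  steinberg_map_rel : forall a, a != 0 -> a != 1 ->
    steinberg_fun a * steinberg_fun (1 - a) = 0
}.

Section Lift.
Variables (F : fieldType) (R : pzRingType) (f : steinberg_map F R).

Fixpoint mterm_eval (t : mterm F) : R :=
  match t with
  | MSym a => f a
  | MZero => 0
  | MOne => 1
  | MOpp x => - mterm_eval x
  | MAdd x y => mterm_eval x + mterm_eval y
  | MMul x y => mterm_eval x * mterm_eval y
  end.

Lemma mterm_eval_eq x y : milnor_eq x y -> mterm_eval x = mterm_eval y.
Proof.
elim=> //=; try by [move=> *; congruence].
- by move=> *; rewrite addrA.
- by move=> *; rewrite addrC.
- by move=> *; rewrite add0r.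
- by move=> *; rewrite addNr.
- by move=> *; rewrite mulrA.
- by move=> *; rewrite mul1r.
- by move=> *; rewrite mulr1.
- by move=> *; rewrite mulrDl.
- by move=> *; rewrite mulrDr.
- exact: steinberg_mapM.
- exact: steinberg_map_rel.
- exact: steinberg_map0.
Qed.

Definition milnor_lift (x : milnorK F) : R := mterm_eval (mrepr x).

Lemma milnor_lift_pi t : milnor_lift (mpi t) = mterm_eval t.
Proof. exact/mterm_eval_eq/mrepr_pi. Qed.

Fact milnor_lift_zmod : zmod_morphism milnor_lift.
Proof.
move=> x y; case: (mpiP x) (mpiP y) => [r ->] [s ->].
by rewrite -mpiN -mpiD !milnor_lift_pi.
Qed.

Fact milnor_lift_monoid : monoid_morphism milnor_lift.
Proof.
split; first by rewrite -mpi1 milnor_lift_pi.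
move=> x y; case: (mpiP x) (mpiP y) => [r ->] [s ->].
by rewrite -mpiM !milnor_lift_pi.
Qed.

HB.instance Definition _ :=
  GRing.isZmodMorphism.Build (milnorK F) R milnor_lift milnor_lift_zmod.
HB.instance Definition _ :=
  GRing.isMonoidMorphism.Build (milnorK F) R milnor_lift milnor_lift_monoid.

Lemma milnor_lift_sym1 a : milnor_lift (sym1 a) = f a.
Proof. exact: milnor_lift_pi. Qed.
End Lift.

Section Generation.
Variable F : fieldType.
Implicit Types (x y : milnorK F) (a b : F) (s t : seq F).

(** Subrings that contain the symbols are everything: this replaces a choice of
    representatives in all later verifications on generators. *)
Lemma milnor_ind (P : milnorK F -> Prop) :
  P 1 -> (forall a, P (sym1 a)) -> (forall x y, P x -> P y -> P (x - y)) ->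
  (forall x y, P x -> P y -> P (x * y)) -> forall x, P x.
Proof.
move=> P1 Psym PB PM x; case: (mpiP x) => t ->.
have P0 : P 0 by rewrite -(subrr 1); apply: PB.
have PN y : P y -> P (- y) by move=> Py; rewrite -[- y]add0r; apply: PB.
elim: t => //= [y IH|y IHy z IHz|y IHy z IHz].
- by rewrite mpiN; apply: PN.
- by rewrite mpiD -[mpi z]opprK; apply/PB/PN.
- by rewrite mpiM; apply: PM.
Qed.

Lemma symbol_nil : symbol [::] = 1 :> milnorK F.
Proof. by rewrite /symbol big_nil. Qed.

Lemma symbol_cons a s : symbol (a :: s) = sym1 a * symbol s.
Proof. by rewrite /symbol big_cons. Qed.

Lemma symbol_cat s t : symbol (s ++ t) = symbol s * symbol t.
Proof. by rewrite /symbol big_cat. Qed.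

Lemma symbol_rcons s a : symbol (rcons s a) = symbol s * sym1 a.
Proof. by rewrite -cats1 symbol_cat symbol_cons symbol_nil mulr1. Qed.

Lemma sym1_1 : sym1 1 = 0 :> milnorK F.
Proof.
by apply: (addrI (sym1 1)); rewrite -sym1M ?oner_neq0// mulr1 addr0.
Qed.

Lemma symbol_mem0 s : 0 \in s -> symbol s = 0.
Proof.
elim: s => //= a s IH; rewrite inE symbol_cons => /orP[/eqP<-|/IH->].
  by rewrite sym1_0 mul0r.
by rewrite mulr0.
Qed.

(** The filtration by the degree, phrased with combinations of symbols of mixed
    lengths so that products and residues are bounded term by term. *)
Definition milnor_deg_lt (N : nat) (x : milnorK F) : Prop :=
  exists s : seq (int * seq F), x = \sum_(p <- s) symbol p.2 *~ p.1 /\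
    all (fun p => size p.2 < N)%N s.

Lemma milnor_deg_lt_symbol N s : (size s < N)%N -> milnor_deg_lt N (symbol s).
Proof.
by move=> sN; exists [:: (1, s)]; rewrite big_seq1 mulr1z /= sN.
Qed.

Lemma milnor_deg_ltB N x y :
  milnor_deg_lt N x -> milnor_deg_lt N y -> milnor_deg_lt N (x - y).
Proof.
move=> [s [-> sN]] [t [-> tN]].
exists (s ++ [seq (- p.1, p.2) | p <- t]); split.
  rewrite big_cat big_map /= -sumrN; congr (_ + _).
  by apply: eq_bigr => p _; rewrite mulrNz.
by rewrite all_cat sN all_map.
Qed.

Lemma milnor_deg_lt0 N : milnor_deg_lt N 0.
Proof. by exists [::]; rewrite big_nil. Qed.

Lemma milnor_deg_ltD N x y :
  milnor_deg_lt N x -> milnor_deg_lt N y -> milnor_deg_lt N (x + y).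
Proof.
move=> xN yN; rewrite -[y]opprK; apply: milnor_deg_ltB => //.
by rewrite -[- y]add0r; apply: milnor_deg_ltB => //; apply: milnor_deg_lt0.
Qed.

Lemma milnor_deg_lt_sum N (I : Type) (r : seq I) (P : pred I)
    (f : I -> milnorK F) :
  (forall j, P j -> milnor_deg_lt N (f j)) ->
  milnor_deg_lt N (\sum_(j <- r | P j) f j).
Proof.
move=> h; apply: big_ind => //; first exact: milnor_deg_lt0.
exact: milnor_deg_ltD.
Qed.

Lemma milnor_deg_ltW N M x : (N <= M)%N -> milnor_deg_lt N x -> milnor_deg_lt M x.
Proof.
move=> NM [s [-> /allP sN]]; exists s; split=> //; apply/allP => p /sN pN.
exact: leq_trans pN NM.
Qed.

Lemma milnor_deg_ltMz N x z : milnor_deg_lt N x -> milnor_deg_lt N (x *~ z).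
Proof.
move=> [s [-> sN]]; exists [seq (z * p.1, p.2) | p <- s]; split.
  by rewrite mulrz_suml big_map; apply: eq_bigr => p _; rewrite /= mulrC mulrzA.
by rewrite all_map.
Qed.

Lemma milnor_deg_ltM N M x y :
  milnor_deg_lt N.+1 x -> milnor_deg_lt M y -> milnor_deg_lt (N + M) (x * y).
Proof.
move=> [s [-> /allP sN]] [t [-> /allP tM]].
rewrite mulr_suml big_seq; apply: milnor_deg_lt_sum => p /sN pN.
rewrite mulr_sumr big_seq; apply: milnor_deg_lt_sum => q /tM qM.
rewrite mulrzAl mulrzAr -symbol_cat; do 2!apply: milnor_deg_ltMz.
by apply: milnor_deg_lt_symbol; rewrite size_cat -addnS leq_add.
Qed.

Lemma milnor_deg_ltP x : exists N, milnor_deg_lt N x.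
Proof.
elim/milnor_ind: x => [|a|x y [N xN] [M yM]|x y [N xN] [M yM]].
- by exists 1%N; rewrite -symbol_nil; apply: milnor_deg_lt_symbol.
- exists 2%N; rewrite -[sym1 a]mulr1 -symbol_nil -symbol_cons.
  exact: milnor_deg_lt_symbol.
- exists (N + M)%N; apply: milnor_deg_ltB.
    by apply: milnor_deg_ltW xN; rewrite leq_addr.
  by apply: milnor_deg_ltW yM; rewrite leq_addl.
- by exists (N + M)%N; apply: milnor_deg_ltM => //; apply: milnor_deg_ltW xN.
Qed.

(** The terms of a combination of symbols are sorted by length. *)
Lemma milnor_deg_ltE N x :
  milnor_deg_lt N x <->
  exists c : forall j, milnorKn F j, x = \sum_(j < N) val (c j).
Proof.
split=> [[s [-> sN]]|[c ->]]; last first.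
  apply: milnor_deg_lt_sum => j _; case: (c j) => z /= /asboolP[s ->].
  apply: milnor_deg_lt_sum => p _; apply: milnor_deg_ltMz.
  by apply: milnor_deg_lt_symbol; rewrite size_tuple.
elim: s sN => [_|[z t] s IH /= /andP[tN /IH[c cE]]].
  by exists (fun=> 0); rewrite big_nil big1.
have dt : symbol t *~ z \in @milnor_deg F (size t).
  by apply/asboolP; exists [:: (z, in_tuple t)]; rewrite big_seq1.
exists (fun j => c j + if eqP is ReflectT e then
   ecast k (milnorKn F k) e (Sub (symbol t *~ z) dt) else 0 :> milnorKn F j).
rewrite big_cons cE [RHS](big_split _) /= addrC; congr (_ + _).
rewrite (bigD1 (Ordinal tN)) //= big1 ?addr0.
  by case: eqP => // e; rewrite (eq_axiomK e).
by move=> j jt; case: eqP => // e; case/eqP: jt; apply/val_inj/esym.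
Qed.
End Generation.
(** * Graded commutativity *)

Lemma mulr_signC (R : pzRingType) (x : R) n : x * (-1) ^+ n = (-1) ^+ n * x.
Proof. exact: commr_sign. Qed.

Lemma mulr_signCA (R : pzRingType) (x y : R) n :
  x * ((-1) ^+ n * y) = (-1) ^+ n * (x * y).
Proof. by rewrite mulrA mulr_signC mulrA. Qed.

Section Commutation.
Variable F : fieldType.
Implicit Types (x y : milnorK F) (a b : F) (s t : seq F).

Lemma sym1V a : sym1 a^-1 = - sym1 a.
Proof.
have [->|a0] := eqVneq a 0; first by rewrite invr0 sym1_0 oppr0.
apply: (addrI (sym1 a)).
by rewrite -sym1M ?invr_eq0// mulfV// sym1_1 subrr.
Qed.

Lemma sym1N1D : sym1 (-1) + sym1 (-1) = 0 :> milnorK F.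
Proof. by rewrite -sym1M ?oppr_eq0 ?oner_neq0// mulrNN mulr1 sym1_1. Qed.

Lemma sym1N1N : - sym1 (-1) = sym1 (-1) :> milnorK F.
Proof. by apply/eqP; rewrite eq_sym -addr_eq0 sym1N1D. Qed.

(** [- a = (1 - a) / (1 - a^-1)], where [{a}] kills the symbol of the numerator
    and [{a^-1} = - {a}] kills that of the denominator. *)
Lemma sym1MN a : sym1 a * sym1 (- a) = 0.
Proof.
have [->|a0] := eqVneq a 0; first by rewrite sym1_0 mul0r.
have [->|a1] := eqVneq a 1; first by rewrite sym1_1 mul0r.
have b0 : 1 - a != 0 by rewrite subr_eq0 eq_sym.
have a'1 : a^-1 != 1 by rewrite invr_eq1.
have c0 : 1 - a^-1 != 0 by rewrite subr_eq0 eq_sym.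
have -> : - a = (1 - a) * (1 - a^-1)^-1.
  apply: (mulIf c0); rewrite mulfVK// mulrBr mulr1 mulNr mulfV//.
  by rewrite opprK addrC.
rewrite sym1M ?invr_eq0// mulrDr sym1_steinberg// add0r sym1V mulrN.
by rewrite -mulNr -sym1V sym1_steinberg ?invr_eq0.
Qed.

Lemma sym1N a : a != 0 -> sym1 (- a) = sym1 (-1) + sym1 a.
Proof. by move=> a0; rewrite -[- a]mulN1r sym1M ?oppr_eq0 ?oner_neq0. Qed.

Lemma sym1_sqr a : sym1 a * sym1 a = sym1 a * sym1 (-1).
Proof.
have [->|a0] := eqVneq a 0; first by rewrite sym1_0 !mul0r.
have := sym1MN a; rewrite sym1N// mulrDr addrC => /eqP.
by rewrite addr_eq0 -mulrN sym1N1N => /eqP.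
Qed.

(** Expand [{a b} {- a b} = 0]. *)
Lemma sym1_anticomm a b : sym1 a * sym1 b = - (sym1 b * sym1 a).
Proof.
have [->|a0] := eqVneq a 0; first by rewrite sym1_0 mul0r mulr0 oppr0.
have [->|b0] := eqVneq b 0; first by rewrite sym1_0 mul0r mulr0 oppr0.
apply/eqP; rewrite -addr_eq0; apply/eqP.
have := sym1MN (a * b); rewrite -mulNr !sym1M ?oppr_eq0//.
rewrite mulrDl !mulrDr sym1MN add0r sym1N// mulrDr sym1_sqr => <-.
by rewrite addrAC -mulrDr sym1N1D mulr0 add0r.
Qed.

(** [{-1}] is killed by 2, so anticommuting with it is commuting with it. *)
Lemma sym1N1_central x : sym1 (-1) * x = x * sym1 (-1).
Proof.
elim/milnor_ind: x => [|a|x y hx hy|x y hx hy]; first by rewrite mulr1 mul1r.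
- by rewrite sym1_anticomm -mulrN sym1N1N.
- by rewrite mulrBr mulrBl hx hy.
- by rewrite mulrA hx -mulrA hy mulrA.
Qed.

Lemma symbol_sym1_comm s a :
  symbol s * sym1 a = (-1) ^+ size s * (sym1 a * symbol s).
Proof.
elim: s => [|b s IH]; first by rewrite symbol_nil mul1r expr0 mul1r mulr1.
rewrite symbol_cons -mulrA IH [LHS]mulrA mulr_signC /= exprS mulN1r mulNr -mulrN.
by rewrite -!mulrA; congr (_ * _); rewrite !mulrA sym1_anticomm mulNr.
Qed.

Lemma symbol_comm s t :
  symbol s * symbol t = (-1) ^+ (size s * size t) * (symbol t * symbol s).
Proof.
elim: t => [|b t IH]; first by rewrite symbol_nil mulr1 mul1r muln0 expr0 mul1r.
rewrite symbol_cons [LHS]mulrA symbol_sym1_comm -[LHS]mulrA -[_ * _ * symbol t]mulrA.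
rewrite IH /= mulnS exprD -mulrA.
by congr (_ * _); rewrite mulrA mulr_signC -!mulrA.
Qed.

Lemma sym1N1X_central n x : sym1 (-1) ^+ n * x = x * sym1 (-1) ^+ n.
Proof.
have c : GRing.comm x (sym1 (-1)) by rewrite /GRing.comm sym1N1_central.
by rewrite (commrX n c).
Qed.

(** The transposition of two letters of a symbol past each other only costs a
    sign, so a repeated letter can be moved next to itself and gives [{-1}]. *)
Lemma symbol_sqr s :
  exists n, symbol s * symbol s = (-1) ^+ n * (sym1 (-1) ^+ size s * symbol s).
Proof.
elim: s => [|a s [n IH]]; first by exists 0; rewrite symbol_nil !mulr1.
exists (size s + n)%N.
rewrite symbol_cons -mulrA [symbol s * (_ * _)]mulrA symbol_sym1_comm -!mulrA IH.
rewrite 3!mulr_signCA exprD -!mulrA; congr (_ * (_ * _)).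
rewrite [LHS]mulrA sym1_sqr -sym1N1_central exprS -!mulrA; congr (_ * _).
by rewrite !mulrA sym1N1X_central.
Qed.

End Commutation.

(** * Multilinear functions and a presentation of the groups of symbols *)

(** Functions of words of arbitrary length, all lengths being treated at once, so
    that prefixing a letter to the argument stays inside the class. *)
Record multilinear (F : fieldType) (A : zmodType) (f : seq F -> A) : Prop := {
  multilinear0 : forall s t, f (s ++ 0 :: t) = 0;
  multilinearM : forall s t a b, a != 0 -> b != 0 ->
    f (s ++ a * b :: t) = f (s ++ a :: t) + f (s ++ b :: t);
  multilinear_rel : forall s t a, a != 0 -> a != 1 ->
    f (s ++ [:: a, 1 - a & t]) = 0
}.

Section MultilinearLift.
Variables (F : fieldType) (A : zmodType).
Implicit Types (f g : seq F -> A) (x y : mterm F).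

(** The right action of the ring terms on the functions of words for which a
    letter acts by prefixing it to the argument. *)
Fixpoint mterm_act x f : seq F -> A :=
  match x with
  | MSym a => fun s => f (a :: s)
  | MZero => fun=> 0
  | MOne => f
  | MOpp x => fun s => - mterm_act x f s
  | MAdd x y => fun s => mterm_act x f s + mterm_act y f s
  | MMul x y => mterm_act y (mterm_act x f)
  end.

Lemma multilinear_act x f : multilinear f -> multilinear (mterm_act x f).
Proof.
elim: x f => [a|||x IHx|x IHx y IHy|x IHx y IHy] f fP //=; last by apply/IHy/IHx.
- split=> s t; first exact: (multilinear0 fP (a :: s)).
    by move=> b c; apply: (multilinearM fP (a :: s)).
  by move=> b; apply: (multilinear_rel fP (a :: s)).
- by split=> *; rewrite ?addr0.
- split=> s t; first by rewrite (multilinear0 (IHx _ fP)) oppr0.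
    by move=> b c b0 c0; rewrite (multilinearM (IHx _ fP))// opprD.
  by move=> b b0 b1; rewrite (multilinear_rel (IHx _ fP))// oppr0.
- split=> s t; first by rewrite !(multilinear0 (IHx _ fP)) (multilinear0 (IHy _ fP)) addr0.
    move=> b c b0 c0; rewrite (multilinearM (IHx _ fP))// (multilinearM (IHy _ fP))//.
    by rewrite addrACA.
  by move=> b b0 b1; rewrite (multilinear_rel (IHx _ fP))// (multilinear_rel (IHy _ fP))// addr0.
Qed.

Lemma mterm_actD x f g :
  mterm_act x (fun s => f s + g s) = fun s => mterm_act x f s + mterm_act x g s.
Proof.
elim: x f g => [a|||x IHx|x IHx y IHy|x IHx y IHy] f g //=.
- by apply/funext => s; rewrite addr0.
- by rewrite IHx; apply/funext => s; rewrite opprD.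
- by rewrite IHx IHy; apply/funext => s; rewrite addrACA.
- by rewrite IHx IHy.
Qed.

(** The relations of the Milnor ring hold for the action because they are imposed
    at every position of the words; the ring axioms hold for any action by additive
    endomorphisms. *)
Lemma mterm_act_eq x y :
  milnor_eq x y -> forall f, multilinear f -> mterm_act x f = mterm_act y f.
Proof.
elim=> {x y} //=.
- by move=> x y _ IH f fP; rewrite IH.
- by move=> y x z _ IH _ IH' f fP; rewrite IH// IH'.
- by move=> x x' _ IH f fP; rewrite IH.
- by move=> x x' y y' _ IH _ IH' f fP; rewrite IH// IH'.
- move=> x x' y y' _ IH _ IH' f fP; rewrite IH// IH'//.
  exact: multilinear_act.
- by move=> x y z f _; apply/funext => s; rewrite addrA.
- by move=> x y f _; apply/funext => s; rewrite addrC.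
- by move=> x f _; apply/funext => s; rewrite add0r.
- by move=> x f _; apply/funext => s; rewrite addNr.
- by move=> x y z f _; rewrite mterm_actD.
- by move=> a b a0 b0 f fP; apply/funext => s; apply: (multilinearM fP [::]).
- by move=> a a0 a1 f fP; apply/funext => s; apply: (multilinear_rel fP [::]).
- by move=> f fP; apply/funext => s; apply: (multilinear0 fP [::]).
Qed.

(** The additive extension of [f] sends [x] to the value at the empty word of
    [f] acted on by [x]. In this way the Milnor ring, defined by generators and
    relations as a ring, is seen to have the expected presentation as a group. *)
Lemma multilinear_lift f : multilinear f ->
  exists g : {additive milnorK F -> A}, forall s, g (symbol s) = f s.
Proof.
move=> fP; pose g (z : milnorK F) := mterm_act (mrepr z) f [::].
have gpi t : g (mpi t) = mterm_act t f [::].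
  by rewrite /g (mterm_act_eq (mrepr_pi t)).
have gB : zmod_morphism g.
  move=> x y; case: (mpiP x) (mpiP y) => [r ->] [s ->].
  by rewrite -mpiN -mpiD !gpi.
pose G : {additive milnorK F -> A} :=
  HB.pack g (GRing.isZmodMorphism.Build _ _ g gB).
exists G => s; change (g (symbol s) = f s).
have e : symbol s = mpi (foldr (fun a => MMul (MSym a)) MOne s).
  elim: s => [|a s IH]; first by rewrite symbol_nil.
  by rewrite symbol_cons IH mpiM.
rewrite e gpi; elim: s f {e fP g gpi gB G} => //= a s IH f; exact: IH.
Qed.
End MultilinearLift.

(** A congruence between formal sums of words that imposes the relations known
    for symbols of length [i]. There is no subtraction of formal sums, so the
    vanishing of the words that contain 1 is a separate condition: it does not
    follow from multilinearity. *)
Record word_congruence (F : fieldType) (i : nat) := WordCongruence {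
  wcong :> seq (seq F) -> seq (seq F) -> Prop;
  wcong_refl : forall s, wcong s s;
  wcong_sym : forall s t, wcong s t -> wcong t s;
  wcong_trans : forall t s u, wcong s t -> wcong t u -> wcong s u;
  wcong_cat : forall s t u, wcong s t -> wcong (s ++ u) (t ++ u);
  wcong_swap : forall s t, all (fun w => size w == i) s ->
    all (fun w => size w == i) t -> wcong (s ++ t) (t ++ s);
  wcongM : forall p q a b, a != 0 -> b != 0 -> size (p ++ a :: q) = i ->
    wcong [:: p ++ a * b :: q] [:: p ++ a :: q; p ++ b :: q];
  wcong1 : forall p q, size (p ++ 1 :: q) = i -> wcong [:: p ++ 1 :: q] [::];
  wcong0 : forall p q, size (p ++ 0 :: q) = i -> wcong [:: p ++ 0 :: q] [::];
  wcong_steinberg : forall p q a, a != 0 -> a != 1 ->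
    size (p ++ [:: a, 1 - a & q]) = i ->
    wcong [:: p ++ [:: a, 1 - a & q]] [::]
}.

Section Presentation.
Variables (F : fieldType) (i : nat) (R : word_congruence F i).
Implicit Types s t u : seq (seq F).

(** Words of the wrong length are discarded, so that the quotient by the relation
    below is a group on which the class of a word of any length makes sense. *)
Definition words_of_size s := [seq w <- s | size w == i].

Lemma wcong_catlr s s' t t' : 
  all (fun w => size w == i) s -> all (fun w => size w == i) s' ->
  all (fun w => size w == i) t -> all (fun w => size w == i) t' ->
  R s s' -> R t t' -> R (s ++ t) (s' ++ t').
Proof.
move=> si s'i ti t'i ss' tt'; apply: (@wcong_trans _ _ R (s' ++ t)).
  exact: wcong_cat.
apply: (@wcong_trans _ _ R (t ++ s')); first exact: wcong_swap.
apply: (@wcong_trans _ _ R (t' ++ s')); first exact: wcong_cat.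
exact: wcong_swap.
Qed.

Definition wrel : rel (seq (seq F)) :=
  fun s t => `[< R (words_of_size s) (words_of_size t) >].

Fact wrel_refl : reflexive wrel.
Proof. by move=> s; apply/asboolP/wcong_refl. Qed.
Fact wrel_sym : symmetric wrel.
Proof. by move=> s t; apply/asboolP/asboolP; apply: wcong_sym. Qed.
Fact wrel_trans : transitive wrel.
Proof. by move=> t s u /asboolP st /asboolP tu; apply/asboolP/(wcong_trans st tu). Qed.

Canonical wrel_equiv := EquivRel wrel wrel_refl wrel_sym wrel_trans.

Definition word_group : Type := {eq_quot wrel_equiv}.
HB.instance Definition _ := Choice.on word_group.

Definition wclass s : word_group := \pi_({eq_quot wrel_equiv}) s.
Definition wrepr (x : word_group) : seq (seq F) := repr (x : {eq_quot wrel_equiv}).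

Lemma wclassP s t : wclass s = wclass t <-> R (words_of_size s) (words_of_size t).
Proof.
by split=> [/eqmodP/asboolP //|st]; apply/eqmodP/asboolP.
Qed.

Lemma wreprK x : wclass (wrepr x) = x.
Proof. exact: reprK. Qed.

Lemma wrepr_class s : R (words_of_size (wrepr (wclass s))) (words_of_size s).
Proof. by apply/wclassP; rewrite wreprK. Qed.

(** Inverting the first letter gives the opposite class. *)
Definition word_inv (w : seq F) := if w is a :: w' then a^-1 :: w' else [::].

Lemma size_word_inv w : size (word_inv w) = size w. Proof. by case: w. Qed.

Definition wadd x y := wclass (wrepr x ++ wrepr y).
Definition wopp x := wclass (map word_inv (wrepr x)).

Lemma waddE s t : wadd (wclass s) (wclass t) = wclass (s ++ t).
Proof.
apply/wclassP; rewrite /words_of_size !filter_cat.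
by apply: wcong_catlr; rewrite ?filter_all//; apply: wrepr_class.
Qed.

Lemma wclassE x : exists s, x = wclass s.
Proof. by exists (wrepr x); rewrite wreprK. Qed.

Lemma waddA : associative wadd.
Proof.
move=> x y z; have [[[s ->] [t ->]] [u ->]] := (wclassE x, wclassE y, wclassE z).
by rewrite !waddE catA.
Qed.

Lemma waddC : commutative wadd.
Proof.
move=> x y; have [[s ->] [t ->]] := (wclassE x, wclassE y).
rewrite !waddE; apply/wclassP; rewrite /words_of_size !filter_cat.
by apply: wcong_swap; apply: filter_all.
Qed.

Lemma wadd0 : left_id (wclass [::]) wadd.
Proof. by move=> x; have [s ->] := wclassE x; rewrite waddE. Qed.

Lemma wclass_size w : size w != i -> wclass [:: w] = wclass [::].
Proof.
by move=> /negPf wi; apply/wclassP; rewrite /words_of_size /= wi; apply: wcong_refl.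
Qed.

Lemma wclass_word s t : all (fun w => size w == i) s ->
  all (fun w => size w == i) t -> R s t -> wclass s = wclass t.
Proof.
by move=> /all_filterP si /all_filterP ti st; apply/wclassP; rewrite /words_of_size si ti.
Qed.

Lemma wclass0 p q : wclass [:: p ++ 0 :: q] = wclass [::].
Proof.
have [wi|/wclass_size->//] := eqVneq (size (p ++ 0 :: q)) i.
by apply: wclass_word; rewrite /= ?wi ?eqxx//; apply: wcong0.
Qed.

Lemma wclass1 p q : wclass [:: p ++ 1 :: q] = wclass [::].
Proof.
have [wi|/wclass_size->//] := eqVneq (size (p ++ 1 :: q)) i.
by apply: wclass_word; rewrite /= ?wi ?eqxx//; apply: wcong1.
Qed.

Lemma wclassM p q a b : a != 0 -> b != 0 ->
  wclass [:: p ++ a * b :: q] = wadd (wclass [:: p ++ a :: q]) (wclass [:: p ++ b :: q]).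
Proof.
move=> a0 b0.
have sz c : size (p ++ c :: q) = size (p ++ a :: q) by rewrite !size_cat.
have [wi|wi] := eqVneq (size (p ++ a :: q)) i.
  by rewrite waddE; apply: wclass_word; rewrite /= ?sz ?wi ?eqxx//; apply: wcongM.
by rewrite !wclass_size ?wadd0// sz.
Qed.

Lemma wclass_rel p q a : a != 0 -> a != 1 ->
  wclass [:: p ++ [:: a, 1 - a & q]] = wclass [::].
Proof.
move=> a0 a1.
have [wi|/wclass_size->//] := eqVneq (size (p ++ [:: a, 1 - a & q])) i.
by apply: wclass_word; rewrite /= ?wi ?eqxx//; apply: wcong_steinberg.
Qed.

Hypothesis i_gt0 : (0 < i)%N.

Lemma wclass_inv w : wclass [:: word_inv w; w] = wclass [::].
Proof.
rewrite -[[:: _; w]]/([:: word_inv w] ++ [:: w]) -waddE.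
case: w => [|a w]; first by rewrite wclass_size ?wadd0// eq_sym -lt0n.
have [->|a0] := eqVneq a 0.
  by rewrite /= invr0 (wclass0 [::]) wadd0.
by rewrite -(@wclassM [::])/= ?invr_eq0// mulVf// (wclass1 [::]).
Qed.

Lemma waddN : left_inverse (wclass [::]) wopp wadd.
Proof.
move=> x; rewrite -{2}[x]wreprK waddE; elim: (wrepr x) => {x} // w s IH.
rewrite -[RHS]IH -[RHS]wadd0 -(wclass_inv w).
rewrite -[w :: s]cat1s map_cat -catA -[[:: _; w]]/([:: word_inv w] ++ [:: w]).
rewrite -!waddE -!waddA; congr wadd.
by rewrite [LHS]waddA [RHS]waddA (waddC (wclass [:: w])).
Qed.

HB.instance Definition _ :=
  GRing.isZmodule.Build word_group waddA waddC wadd0 waddN.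

Lemma multilinear_wclass : multilinear (fun w => wclass [:: w] : word_group).
Proof.
split=> p q; first exact: wclass0.
  by move=> a b; apply: wclassM.
by move=> a; apply: wclass_rel.
Qed.

(** The group of formal sums of words modulo the congruence receives a map from
    the Milnor ring, because sending a word to its class is multilinear. *)
Theorem symbol_sum_wcong s t : all (fun w => size w == i) s ->
  all (fun w => size w == i) t ->
  \sum_(w <- s) symbol w = \sum_(w <- t) symbol w -> R s t.
Proof.
move=> si ti.
have [g gE] := multilinear_lift multilinear_wclass.
have sumE u : g (\sum_(w <- u) symbol w) = wclass u.
  elim: u => [|w u IH]; first by rewrite big_nil raddf0.
  by rewrite big_cons raddfD IH gE; apply: waddE.
move=> /(congr1 g); rewrite !sumE => /wclassP.
by move/all_filterP: si; move/all_filterP: ti; rewrite /words_of_size => -> ->.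
Qed.

End Presentation.

(** * Elementary symmetric functions of symbols *)

Section ElemSym.
Variable R : pzRingType.
Implicit Types (x : R) (s t : seq R).

Lemma elem_sym0 s : elem_sym 0 s = 1.
Proof.
rewrite /elem_sym (big_pred1 finset.set0) ?big_set0// => A.
by rewrite /= cards_eq0.
Qed.

Lemma elem_sym_nil n : elem_sym n.+1 [::] = 0 :> R.
Proof.
rewrite /elem_sym big_pred0// => A.
by apply/negbTE; rewrite neq_ltn (leq_ltn_trans (max_card _)) ?card_ord.
Qed.

(** Sort the sets of indices by whether they contain the first one. *)
Lemma elem_sym_cons n x s :
  elem_sym n.+1 (x :: s) = elem_sym n.+1 s + x * elem_sym n s.
Proof.
pose up (B : {set 'I_(size s)}) := [set lift ord0 j | j in B].
pose down (A : {set 'I_(size s).+1}) := [set j | lift ord0 j \in A]%SET.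
have upE B j : (lift ord0 j \in up B) = (j \in B).
  by rewrite mem_imset//; apply: lift_inj.
have up0 B : ord0 \notin up B.
  by apply/imsetP => -[j _] /eqP; rewrite -val_eqE.
have cardup B : #|up B| = #|B| by rewrite card_imset//; apply: lift_inj.
have ordP (P : 'I_(size s).+1 -> Prop) :
    P ord0 -> (forall j, P (lift ord0 j)) -> forall j, P j.
  by move=> P0 Pl j; case: (unliftP ord0 j) => [k|] ->.
rewrite /elem_sym /= (bigID (fun A : {set _} => ord0 \in A)) /= addrC; congr (_ + _).
  rewrite (reindex_onto up down) /=; last first.
    move=> A /andP[_ A0]; apply/setP; apply: ordP => [|j].
      by rewrite (negbTE A0) (negbTE (up0 _)).
    by rewrite upE finset.inE.
  apply: eq_big => [B|B _].
    rewrite cardup up0 andbT [X in _ && X](_ : _ = true) ?andbT//.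
    by apply/eqP/setP => j; rewrite finset.inE upE.
  rewrite big_mkcond big_ord_recl (negbTE (up0 B)) Monoid.mul1m [RHS]big_mkcond. 
  by apply: eq_bigr => j _; rewrite upE.
rewrite (reindex_onto (fun B => ord0 |: up B) down) /=; last first.
  move=> A /andP[_ A0]; apply/setP; apply: ordP => [|j].
    by rewrite !finset.inE A0.
  by rewrite !finset.inE /= upE finset.inE.
rewrite big_distrr /=; apply: eq_big => [B|B _].
  rewrite cardsU1 up0 cardup add1n eqSS setU11 andbT.
  rewrite [X in _ && X](_ : _ = true) ?andbT//.
  by apply/eqP/setP => j; rewrite !finset.inE /= upE.
rewrite big_mkcond big_ord_recl setU11 /= [in RHS]big_mkcond; congr (_ * _).
by apply: eq_bigr => j _; rewrite !finset.inE /= upE.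
Qed.

Lemma elem_sym1 s : elem_sym 1 s = \sum_(x <- s) x.
Proof.
elim: s => [|x s IH]; first by rewrite elem_sym_nil big_nil.
by rewrite elem_sym_cons elem_sym0 mulr1 IH big_cons addrC.
Qed.

Lemma elem_sym_gt n s : (size s < n)%N -> elem_sym n s = 0.
Proof.
elim: s n => [|x s IH] [|n]//= sn; first exact: elem_sym_nil.
by rewrite elem_sym_cons !IH ?mulr0 ?addr0// ltnW.
Qed.

Lemma elem_sym_cat n s t :
  elem_sym n (s ++ t) = \sum_(j < n.+1) elem_sym j s * elem_sym (n - j) t.
Proof.
elim: s n => [|x s IH] n /=.
  rewrite big_ord_recl elem_sym0 subn0 mul1r big1 ?addr0// => j _.
  by rewrite elem_sym_nil mul0r.
case: n => [|n]; first by rewrite big_ord1 !elem_sym0 mulr1.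
rewrite elem_sym_cons !IH big_ord_recl [in RHS]big_ord_recl !elem_sym0 -addrA.
congr (_ + _); rewrite mulr_sumr -big_split; apply: eq_bigr => j _ /=.
by rewrite elem_sym_cons mulrDl mulrA.
Qed.

Lemma elem_sym_rcons n s x :
  elem_sym n.+1 (rcons s x) = elem_sym n.+1 s + elem_sym n s * x.
Proof.
rewrite -cats1 elem_sym_cat !big_ord_recr /= subnn subSnn elem_sym0 mulr1.
rewrite elem_sym1 big_seq1 big1 ?add0r 1?addrC// => j _.
by rewrite [elem_sym _ [:: x]]elem_sym_gt ?mulr0//= ltn_subRL addn1 ltnS.
Qed.

Lemma elem_sym_size s : elem_sym (size s) s = \prod_(x <- s) x.
Proof.
elim: s => [|x s IH]; first by rewrite elem_sym0 big_nil.
by rewrite /= elem_sym_cons elem_sym_gt// add0r IH big_cons.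
Qed.
End ElemSym.

Lemma rmorph_elem_sym (R S : pzRingType) (f : {rmorphism R -> S}) n s :
  f (elem_sym n s) = elem_sym n (map f s).
Proof.
elim: s n => [|x s IH] [|n] /=; rewrite ?elem_sym0 ?elem_sym_nil ?rmorph1 ?rmorph0//.
by rewrite !elem_sym_cons rmorphD rmorphM !IH.
Qed.

Section Independence.
Variables (F : fieldType) (i : nat).
Implicit Types (x y z : milnorK F) (a b : F) (p q w : seq F) (s t : seq (seq F)).

Local Notation esym n s := (elem_sym n (map (@symbol F) s)).

Lemma symbol_insert p q a :
  symbol (p ++ a :: q) = (-1) ^+ size p * symbol (a :: p ++ q).
Proof.
by rewrite symbol_cat symbol_cons mulrA symbol_sym1_comm -!mulrA symbol_cons symbol_cat.
Qed.

(** Two symbols that differ in one entry only share [i - 1] entries, and each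
    repeated entry produces a factor [{-1}]. *)
Lemma symbolM_share p q a b :
  exists n, symbol (p ++ a :: q) * symbol (p ++ b :: q) =
    (-1) ^+ n * (sym1 (-1) ^+ size (p ++ q) * symbol [:: a, b & p ++ q]).
Proof.
rewrite !symbol_insert; move: (p ++ q) => r; have [n rr] := symbol_sqr r.
exists (size p + (size p + (size r + n)))%N.
rewrite -mulrA mulr_signCA !exprD -!mulrA; congr (_ * (_ * _)).
rewrite !symbol_cons -mulrA [symbol r * (_ * _)]mulrA symbol_sym1_comm -!mulrA rr.
rewrite mulr_signCA [sym1 b * _]mulr_signCA [sym1 a * (_ ^+ n * _)]mulr_signCA; congr (_ * (_ * _)).
rewrite [sym1 b * (_ ^+ _ * _)]mulrA -sym1N1X_central -mulrA.
by rewrite [sym1 a * (_ ^+ _ * _)]mulrA -sym1N1X_central -mulrA.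
Qed.

Section Coefficient.
Variable y : milnorK F.
Hypotheses (i_gt0 : (0 < i)%N) (yP : gamma_coef i y).

Lemma gamma_coef_share p q a b : size (p ++ a :: q) = i ->
  y * (symbol (p ++ a :: q) * symbol (p ++ b :: q)) = 0.
Proof.
rewrite size_cat /= addnS => szi; case: yP => ty _.
have [n ->] := symbolM_share p q a b.
rewrite mulr_signCA [y * (_ ^+ _ * _)]mulrA -sym1N1X_central size_cat.
by move: ty; rewrite /tau -szi /= => ->; rewrite mul0r mulr0.
Qed.

(** The symbols need not commute, but they may be permuted in a product that has
    [y] as its left factor. *)
Definition commutes_under_coef x := forall z w : milnorK F, 
  y * (z * (x * w)) = y * (z * (w * x)).

Lemma commutes_under_coef1 : commutes_under_coef 1.
Proof. by move=> z w; rewrite mulr1 mul1r. Qed.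

Lemma commutes_under_coef0 : commutes_under_coef 0.
Proof. by move=> z w; rewrite mulr0 mul0r. Qed.

Lemma commutes_under_coefD x x' : commutes_under_coef x ->
  commutes_under_coef x' -> commutes_under_coef (x + x').
Proof. by move=> hx hx' z w; rewrite mulrDl !mulrDr hx hx'. Qed.

Lemma commutes_under_coefM x x' : commutes_under_coef x ->
  commutes_under_coef x' -> commutes_under_coef (x * x').
Proof.
move=> hx hx' z w; rewrite -[x * x' * w]mulrA [z * (x * _)]mulrA hx'.
by rewrite -mulrA hx -mulrA [z * _]mulrA hx' -mulrA.
Qed.

(** Symbols of even length are central; those of odd length commute up to sign,
    and then the coefficient is killed by 2. *)
Lemma commutes_under_coef_symbol w : size w = i -> commutes_under_coef (symbol w).
Proof.
move=> wi z x; have symP u : symbol w * symbol u = symbol u * symbol w \/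
    y *+ 2 = 0 /\ symbol w * symbol u = - (symbol u * symbol w).
  rewrite symbol_comm -signr_odd oddM wi.
  case odd_i: (odd i) => /=; last by left; rewrite mul1r.
  case: (odd (size u)) => /=; last by left; rewrite mul1r.
  by right; split; [case: yP => _; apply | rewrite mulN1r].
have [_ [s [-> _]]] := milnor_deg_ltP x.
rewrite mulr_sumr !mulr_suml !mulr_sumr; apply: eq_bigr => -[m u] _ /=.
rewrite mulrzAr mulrzAl !mulrzAr; congr (_ *~ _).
have [->//|[y2 ->]] := symP u.
rewrite !mulrN; apply/eqP; rewrite eq_sym -addr_eq0 -mulr2n.
by rewrite -mulrnAl y2 mul0r.
Qed.

Lemma commutes_under_coef_esym n s : all (fun w => size w == i) s ->
  commutes_under_coef (esym n s).
Proof.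
elim: s n => [|w s IH] [|n] /= => [_|_|_|/andP[/eqP wi si]].
- by rewrite elem_sym0; apply: commutes_under_coef1.
- by rewrite elem_sym_nil; apply: commutes_under_coef0.
- by rewrite elem_sym0; apply: commutes_under_coef1.
rewrite elem_sym_cons; apply: commutes_under_coefD; first exact: IH.
apply: commutes_under_coefM; last exact: IH.
exact: commutes_under_coef_symbol.
Qed.

(** The sums themselves are compared too, because they enter the expansion of the
    higher symmetric functions of a concatenation. *)
Definition gamma_rel s t := \sum_(w <- s) symbol w = \sum_(w <- t) symbol w /\
  forall n, (1 < n)%N -> y * esym n s = y * esym n t.

Lemma gamma_rel_cat s t u : gamma_rel s t -> gamma_rel (s ++ u) (t ++ u).
Proof.
case=> e1 en; split; first by rewrite !big_cat /= e1.
move=> n n1; rewrite !map_cat !elem_sym_cat !mulr_sumr; apply: eq_bigr => j _.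
case: (nat_of_ord j) => [|[|k]]; rewrite ?elem_sym0//.
  by rewrite !elem_sym1 !big_map e1.
by rewrite !mulrA en.
Qed.

Lemma gamma_rel_swap s t : all (fun w => size w == i) s ->
  all (fun w => size w == i) t -> gamma_rel (s ++ t) (t ++ s).
Proof.
move=> si ti; split; first by rewrite !big_cat /= addrC.
move=> n _; rewrite !map_cat !elem_sym_cat !mulr_sumr.
rewrite [RHS](reindex_inj rev_ord_inj) /=; apply: eq_bigr => j _.
rewrite subSS subKn; last by rewrite -ltnS.
by have := commutes_under_coef_esym j si 1 (esym (n - j) t); rewrite !mul1r.
Qed.

Lemma gamma_rel0 w : symbol w = 0 -> gamma_rel [:: w] [::].
Proof.
move=> w0; split; first by rewrite big_seq1 big_nil.
by move=> n n1; rewrite !elem_sym_gt// ltnW.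
Qed.

(** Splitting a symbol into two changes the [n]-th symmetric function only for
    [n = 2], by the product of the two new symbols, which share [i - 1] entries. *)
Lemma gamma_relM p q a b : a != 0 -> b != 0 -> size (p ++ a :: q) = i ->
  gamma_rel [:: p ++ a * b :: q] [:: p ++ a :: q; p ++ b :: q].
Proof.
move=> a0 b0 szi; split.
  rewrite !big_cons !big_nil !addr0 !symbol_cat !symbol_cons sym1M//.
  by rewrite mulrDl mulrDr.
move=> n n1; rewrite [X in y * X]elem_sym_gt//.
move: n1; rewrite leq_eqVlt => /orP[/eqP<-|n2]; last by rewrite elem_sym_gt.
rewrite /= elem_sym_cons [elem_sym 2 _]elem_sym_gt// add0r elem_sym1 big_seq1.
by rewrite gamma_coef_share// mulr0.
Qed.

Definition gamma_congruence : word_congruence F i.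
Proof.
refine (@WordCongruence F i gamma_rel _ _ _ gamma_rel_cat gamma_rel_swap
  gamma_relM _ _ _).
- by [].
- by move=> s t [e1 en]; split=> // n n1; rewrite en.
- by move=> t s u [e1 en] [e1' en']; split=> [|n n1]; rewrite ?e1// en// en'.
- move=> p q _; apply: gamma_rel0.
  by rewrite symbol_cat symbol_cons sym1_1 mul0r mulr0.
- by move=> p q _; apply: gamma_rel0; rewrite symbol_mem0// mem_cat mem_head orbT.
- move=> p q a a0 a1 _; apply: gamma_rel0.
  by rewrite symbol_cat 2!symbol_cons [_ * (_ * symbol q)]mulrA sym1_steinberg// mul0r mulr0.
Defined.

(** The divided power [y . gamma_n] is well defined: equal sums of symbols are
    linked by the relations of the presentation, and each of them preserves [y]
    times the symmetric functions. *)
Lemma esym_coef_indep n s t : (1 < n)%N ->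
  all (fun w => size w == i) s -> all (fun w => size w == i) t ->
  \sum_(w <- s) symbol w = \sum_(w <- t) symbol w ->
  y * esym n s = y * esym n t.
Proof.
move=> n1 si ti st.
have [_ h] : gamma_rel s t := @symbol_sum_wcong _ _ gamma_congruence i_gt0 s t si ti st.
exact: h.
Qed.
End Coefficient.
End Independence.

(** * Specialization and residue at a discrete valuation *)

Section Mx2.
Variable R : pzRingType.
Implicit Types a b d : R.

Definition utmx a b d : 'M[R]_2 :=
  \matrix_(i, j) if i == 0 then if j == 0 then a else b
                 else if j == 0 then 0 else d.

Lemma utmx00 a b d : utmx a b d 0 0 = a. Proof. by rewrite mxE. Qed.
Lemma utmx01 a b d : utmx a b d 0 1 = b. Proof. by rewrite mxE. Qed.
Lemma utmx11 a b d : utmx a b d 1 1 = d. Proof. by rewrite mxE. Qed.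

Lemma mx2P (A B : 'M[R]_2) :
  A 0 0 = B 0 0 -> A 0 1 = B 0 1 -> A 1 0 = B 1 0 -> A 1 1 = B 1 1 -> A = B.
Proof.
move=> e00 e01 e10 e11; apply/matrixP => i j.
have ord2 (k : 'I_2) : k = 0 \/ k = 1.
  by case: k => -[|[|]]// k2; [left|right]; apply: val_inj.
by case: (ord2 i) (ord2 j) => -> [] ->.
Qed.

Lemma utmxD a b d a' b' d' :
  utmx a b d + utmx a' b' d' = utmx (a + a') (b + b') (d + d').
Proof. by apply: mx2P; rewrite !mxE /= ?addr0. Qed.

Lemma utmxM a b d a' b' d' :
  utmx a b d * utmx a' b' d' = utmx (a * a') (a * b' + b * d') (d * d').
Proof.
apply: mx2P; rewrite !mxE !big_ord_recl big_ord0 !mxE /= ?addr0//;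
by rewrite ?mulr0 ?mul0r ?addr0 ?add0r.
Qed.

Lemma utmx0 : utmx 0 0 0 = 0.
Proof. by apply: mx2P; rewrite !mxE. Qed.

Lemma utmx1 : utmx 1 0 1 = 1.
Proof. by apply: mx2P; rewrite !mxE. Qed.
End Mx2.

Section Tame.
Variables (K kappa : fieldType) (v : K -> int) (res : K -> kappa) (p : K).
Hypotheses (hv : discrete_valuation v) (hr : residue_field v res).
Hypothesis hp : uniformizer v p.
Implicit Types (a b u : K) (w : milnorK K).

Let p0 : p != 0. Proof. by case: hp. Qed.

Lemma dvalN1 : v (-1) = 0.
Proof.
have N1 : -1 != 0 :> K by rewrite oppr_eq0 oner_neq0.
have := dval_mul hv N1 N1; rewrite mulrNN mulr1 (dval1 hv) -mulr2n => /esym/eqP.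
by rewrite mulrn_eq0 => /eqP.
Qed.

Lemma dvalN a : a != 0 -> v (- a) = v a.
Proof.
move=> a0; rewrite -[- a]mulN1r (dval_mul hv) ?dvalN1 ?add0r//.
by rewrite oppr_eq0 oner_neq0.
Qed.

Definition unit_part a := a / p ^ v a.

Lemma unit_part_neq0 a : a != 0 -> unit_part a != 0.
Proof. by move=> a0; rewrite mulf_neq0// invr_eq0 expfz_neq0. Qed.

Lemma dval_unit_part a : a != 0 -> v (unit_part a) = 0.
Proof.
move=> a0; rewrite (dval_mul hv) ?invr_eq0 ?expfz_neq0//.
by rewrite (dvalV hv) ?expfz_neq0// (dvalXz hv hp) subrr.
Qed.

Lemma unit_partM a b : a != 0 -> b != 0 ->
  unit_part (a * b) = unit_part a * unit_part b.
Proof.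
by move=> a0 b0; rewrite /unit_part (dval_mul hv)// expfzDr// invfM mulrACA.
Qed.

Lemma unit_part_unit u : v u = 0 -> unit_part u = u.
Proof. by move=> vu; rewrite /unit_part vu expr0z divr1. Qed.

Lemma res0 : res 0 = 0.
Proof. by apply/(res_ker hr); left. Qed.

Lemma resN1 : res (-1) = -1.
Proof.
apply/eqP; rewrite -addr_eq0 -[X in _ + X](res_1 hr) -(res_add hr).
- by rewrite addNr res0.
- by right; rewrite dvalN1.
- by right; rewrite (dval1 hv).
Qed.

Lemma res_neq0 u : u != 0 -> v u = 0 -> res u != 0.
Proof.
move=> u0 vu; apply/eqP => /(res_ker hr) []; first by right; rewrite vu.
  by move=> /eqP; rewrite (negPf u0).
by rewrite vu ltxx.
Qed.

(** The residue of the coefficient [u] in [a = p^n u]. *)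
Definition leading a := res (unit_part a).

Lemma leading_neq0 a : a != 0 -> leading a != 0.
Proof. by move=> a0; rewrite res_neq0 ?unit_part_neq0 ?dval_unit_part. Qed.

Lemma leading_unit u : v u = 0 -> leading u = res u.
Proof. by move=> vu; rewrite /leading unit_part_unit. Qed.

Lemma leadingM a b : a != 0 -> b != 0 -> leading (a * b) = leading a * leading b.
Proof.
move=> a0 b0; rewrite /leading unit_partM// (res_mul hr)//.
  by right; rewrite dval_unit_part.
by right; rewrite dval_unit_part.
Qed.

Lemma leadingN a : a != 0 -> leading (- a) = - leading a.
Proof.
move=> a0; rewrite -mulN1r leadingM ?oppr_eq0 ?oner_neq0//.
by rewrite leading_unit ?dvalN1// resN1 mulN1r.
Qed.

Lemma one_sub_small a : a != 0 -> a != 1 -> 0 < v a ->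
  v (1 - a) = 0 /\ res (1 - a) = 1.
Proof.
move=> a0 a1 va; have b0 : 1 - a != 0 by rewrite subr_eq0 eq_sym.
have Na0 : - a != 0 by rewrite oppr_eq0.
have bO : 0 <= v (1 - a).
  by apply: le_trans (dval_add hv _ Na0 b0); rewrite ?oner_neq0// (dval1 hv) dvalN// le_min lexx ltW.
have resb : res (1 - a) = 1.
  rewrite (res_add hr); last by right; rewrite dvalN// ltW.
    by rewrite (res_1 hr) (_ : res (- a) = 0) ?addr0//; apply/(res_ker hr); right; rewrite dvalN// ltW.
  by right; rewrite (dval1 hv).
split=> //; apply/eqP; rewrite eq_le bO andbT leNgt; apply/negP => vb.
have /eqP := resb; rewrite (_ : res _ = 0) ?(eq_sym 0) ?oner_eq0//.
by apply/(res_ker hr); right=> //; apply: ltW.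
Qed.

(** Serre's construction: the residue and specialization maps are the entries of
    one multiplicative map to triangular matrices.  The lower diagonal entry is
    specialization at [- p], twisted by the sign of the degree, which makes the
    off-diagonal entry a skew derivation. *)
Definition tame_fun a : 'M[milnorK kappa]_2 :=
  if a == 0 then 0 else
  utmx (sym1 (leading a)) (v a)%:~R (sym1 (-1) *~ v a - sym1 (leading a)).

Lemma tame_funE a : a != 0 -> tame_fun a =
  utmx (sym1 (leading a)) (v a)%:~R (sym1 (-1) *~ v a - sym1 (leading a)).
Proof. by rewrite /tame_fun => /negPf ->. Qed.

Fact tame_fun0 : tame_fun 0 = 0. Proof. by rewrite /tame_fun eqxx. Qed.

Fact tame_funM a b : a != 0 -> b != 0 -> tame_fun (a * b) = tame_fun a + tame_fun b.
Proof.
move=> a0 b0; rewrite !tame_funE ?mulf_neq0// utmxD leadingM// (dval_mul hv)//.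
by rewrite sym1M ?leading_neq0// intrD mulrzDr opprD addrACA.
Qed.

Lemma tame_fun_one u : u != 0 -> v u = 0 -> res u = 1 -> tame_fun u = 0.
Proof.
move=> u0 vu ru; rewrite tame_funE// vu leading_unit// ru sym1_1 subr0.
by rewrite mulr0z utmx0.
Qed.

(** [{-1} *~ n] only depends on the parity of [n]. *)
Lemma sym1N1_mulz (n : int) :
  sym1 (-1) *~ n = 0 :> milnorK kappa \/ sym1 (-1) *~ n = sym1 (-1) :> milnorK kappa.
Proof.
have h m : sym1 (-1) *+ m = 0 :> milnorK kappa \/ sym1 (-1) *+ m = sym1 (-1) :> milnorK kappa.
  elim: m => [|m [IH|IH]]; first by left.
    by right; rewrite mulrS IH addr0.
  by left; rewrite mulrS IH sym1N1D.
case: n => m; first exact: h.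
by rewrite NegzE mulrNz -pmulrn; case: (h m.+1) => ->;
   rewrite ?oppr0 ?sym1N1N; [left|right].
Qed.

Fact tame_fun_rel a : a != 0 -> a != 1 -> tame_fun a * tame_fun (1 - a) = 0.
Proof.
move=> a0 a1; have b0 : 1 - a != 0 by rewrite subr_eq0 eq_sym.
have b1 : 1 - a != 1 by rewrite -subr_eq0 addrAC subrr sub0r oppr_eq0.
case: (ltgtP (v a) 0) => va.
(* [1 - a = - a (1 - a^-1)] where the second factor has residue 1, so that up to
   sign the second entry of the symbol is the first one. *)
- have a'0 : a^-1 != 0 by rewrite invr_eq0.
  have a'1 : a^-1 != 1 by rewrite invr_eq1.
  have [vc rc] : v (1 - a^-1) = 0 /\ res (1 - a^-1) = 1.
    by apply: one_sub_small => //; rewrite (dvalV hv)// oppr_gt0.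
  have bE : 1 - a = - a * (1 - a^-1).
    by rewrite mulrBr mulr1 mulNr mulfV// opprK addrC.
  have c0 : 1 - a^-1 != 0 by rewrite subr_eq0 eq_sym.
  have Na0 : - a != 0 by rewrite oppr_eq0.
  rewrite bE tame_funM// [X in _ + X]tame_fun_one// addr0 !tame_funE//.
  rewrite dvalN// leadingN// utmxM sym1MN sym1N ?leading_neq0//.
  have xx := sym1_sqr (leading a); set x := sym1 (leading a) in xx *.
  have cx := sym1N1_central x; set e := sym1 (-1) in xx cx *.
  rewrite -[RHS](utmx0 (milnorK kappa)); congr utmx.
    rewrite mulrzr mulrzl -mulrzDl.
    case: (sym1N1_mulz (v a)); rewrite -/e => E.
      by rewrite E sub0r opprD addrCA subrr addr0 mulNrz E oppr0.
    by rewrite E opprD addNKr subrr mul0rz.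
  case: (sym1N1_mulz (v a)); rewrite -/e => ->.
    by rewrite !sub0r mulrNN mulrDr xx -mulrDr sym1N1D mulr0.
  by rewrite opprD addNKr mulrN mulrBl xx cx subrr oppr0.
- by have [vb rb] := one_sub_small a0 a1 va; rewrite [X in _ * X]tame_fun_one ?mulr0.
have aO : valuation_ring v a by right; rewrite va.
have NaO : valuation_ring v (- a) by right; rewrite dvalN// va.
have oneO : valuation_ring v 1 by right; rewrite (dval1 hv).
have bO : 0 <= v (1 - a).
  have Na0 : - a != 0 by rewrite oppr_eq0.
  by apply: le_trans (dval_add hv _ Na0 b0); rewrite ?oner_neq0// (dval1 hv) dvalN// va minxx.
have [vb|] := ltP 0 (v (1 - a)).
  have [va' ra] := one_sub_small b0 b1 vb.
  by move: va' ra; rewrite opprB addrC subrK => va' ra; rewrite tame_fun_one ?mul0r.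
move=> vb; have {}vb : v (1 - a) = 0 by apply/eqP; rewrite eq_le vb.
have rb : res (1 - a) = 1 - res a.
  rewrite (res_add hr)// (res_1 hr) -mulN1r (res_mul hr)// ?resN1 ?mulN1r//.
  by right; rewrite dvalN1.
have ra0 : res a != 0 by apply: res_neq0.
have ra1 : res a != 1.
  by rewrite eq_sym -subr_eq0 -rb; apply: res_neq0.
rewrite !tame_funE// va vb !leading_unit// rb utmxM sym1_steinberg//.
rewrite -[RHS](utmx0 (milnorK kappa)); congr utmx.
  by rewrite !mulr0z mulr0 mul0r addr0.
by rewrite !mulr0z !sub0r mulrNN sym1_steinberg.
Qed.

Definition tame_steinberg : steinberg_map K 'M[milnorK kappa]_2 :=
  SteinbergMap tame_fun0 tame_funM tame_fun_rel.

Definition tame : {rmorphism milnorK K -> 'M[milnorK kappa]_2} :=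
  milnor_lift tame_steinberg.

Lemma tame_sym1 a : a != 0 -> tame (sym1 a) =
  utmx (sym1 (leading a)) (v a)%:~R (sym1 (-1) *~ v a - sym1 (leading a)).
Proof. by move=> a0; rewrite -tame_funE//; apply: milnor_lift_sym1. Qed.

Definition spec w := tame w 0 0.
Definition residue w := tame w 0 1.
Definition twisted_spec w := tame w 1 1.

Lemma tameE w : tame w = utmx (spec w) (residue w) (twisted_spec w).
Proof.
suff t10 : tame w 1 0 = 0 by apply: mx2P; rewrite ?utmx00 ?utmx01 ?utmx11// t10 mxE.
elim/milnor_ind: w => [|a|x y hx hy|x y hx hy].
- by rewrite rmorph1 -utmx1 mxE.
- have [->|a0] := eqVneq a 0; first by rewrite sym1_0 rmorph0 mxE.
  by rewrite tame_sym1// mxE.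
- by rewrite rmorphB mxE mxE hx hy subr0.
- by rewrite rmorphM mxE big_ord_recl big_ord1 /= hx (_ : lift _ _ = 1) ?hy ?mul0r ?mulr0 ?addr0//; apply: val_inj.
Qed.

Fact spec_zmod : zmod_morphism spec.
Proof. by move=> x y; rewrite /spec rmorphB !mxE. Qed.
Fact spec_monoid : monoid_morphism spec.
Proof.
split; first by rewrite /spec rmorph1 mxE.
by move=> x y; rewrite {1}/spec rmorphM (tameE x) (tameE y) utmxM utmx00.
Qed.
HB.instance Definition _ :=
  GRing.isZmodMorphism.Build (milnorK K) (milnorK kappa) spec spec_zmod.
HB.instance Definition _ :=
  GRing.isMonoidMorphism.Build (milnorK K) (milnorK kappa) spec spec_monoid.

Fact residue_zmod : zmod_morphism residue.
Proof. by move=> x y; rewrite /residue rmorphB !mxE. Qed.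
HB.instance Definition _ :=
  GRing.isZmodMorphism.Build (milnorK K) (milnorK kappa) residue residue_zmod.

Lemma residueM x y :
  residue (x * y) = spec x * residue y + residue x * twisted_spec y.
Proof. by rewrite {1}/residue rmorphM (tameE x) (tameE y) utmxM utmx01. Qed.

Lemma twisted_specM x y :
  twisted_spec (x * y) = twisted_spec x * twisted_spec y.
Proof. by rewrite /twisted_spec rmorphM (tameE x) (tameE y) utmxM !utmx11. Qed.

Lemma residue1 : residue 1 = 0.
Proof. by rewrite /residue rmorph1 mxE. Qed.

Lemma spec_sym1 a : a != 0 -> spec (sym1 a) = sym1 (leading a).
Proof. by move=> a0; rewrite /spec tame_sym1// utmx00. Qed.

Lemma residue_sym1 a : a != 0 -> residue (sym1 a) = (v a)%:~R.
Proof. by move=> a0; rewrite /residue tame_sym1// utmx01. Qed.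

Lemma twisted_spec_sym1 a : a != 0 ->
  twisted_spec (sym1 a) = sym1 (-1) *~ v a - sym1 (leading a).
Proof. by move=> a0; rewrite /twisted_spec tame_sym1// utmx11. Qed.

Lemma spec_is_specialization : is_specialization v res p spec.
Proof.
move=> s hs; rewrite -[LHS]/(spec _) /symbol !big_map rmorph_prod big_seq [RHS]big_seq.
apply: eq_bigr => -[n u] /hs[/= u0 vu].
have pn0 : p ^ n != 0 by rewrite expfz_neq0.
rewrite spec_sym1 ?mulf_neq0// leadingM// (leading_unit vu).
suff -> : leading (p ^ n) = 1 by rewrite mul1r.
by rewrite /leading /unit_part (dvalXz hv hp) divff// (res_1 hr).
Qed.

(** Each diagonal entry of the matrix of a symbol has the degree of the symbol,
    and the off-diagonal entry has one degree less. *)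
Lemma residue_deg_lt N w : milnor_deg_lt N.+1 w -> milnor_deg_lt N (residue w).
Proof.
case=> s [-> /allP sN]; rewrite raddf_sum big_seq.
apply: milnor_deg_lt_sum => -[m t] /sN /=; rewrite ltnS raddfMz => tN.
apply: milnor_deg_ltMz.
suff : [/\ milnor_deg_lt (size t).+1 (spec (symbol t)),
    milnor_deg_lt (size t) (residue (symbol t)) &
    milnor_deg_lt (size t).+1 (twisted_spec (symbol t))].
  by case=> _ h _; apply: milnor_deg_ltW h.
have deg_sym1 (a : kappa) : milnor_deg_lt 2 (sym1 a).
  rewrite -[sym1 a]mulr1 -symbol_nil -symbol_cons.
  exact: milnor_deg_lt_symbol.
have deg_1 : milnor_deg_lt 1 (1 : milnorK kappa).
  by rewrite -symbol_nil; apply: milnor_deg_lt_symbol.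
elim: t {tN sN} => [|a t [IHs IHr IHt]].
  rewrite symbol_nil /spec /residue /twisted_spec rmorph1 !mxE /=.
  by split=> //; apply: milnor_deg_lt0.
have [->|a0] := eqVneq a 0.
  rewrite symbol_mem0 ?mem_head// /spec /residue /twisted_spec rmorph0 !mxE.
  by split; apply: milnor_deg_lt0.
rewrite symbol_cons rmorphM residueM /= -/(spec _).
rewrite twisted_specM spec_sym1// residue_sym1// twisted_spec_sym1//; split.
- by rewrite -[(size t).+2]add1n; apply: milnor_deg_ltM.
- apply: milnor_deg_ltD; first by rewrite -[(size t).+1]add1n; apply: milnor_deg_ltM.
  by rewrite -[(size t).+1]add0n; apply: milnor_deg_ltM => //; apply: milnor_deg_ltMz.
- rewrite -[(size t).+2]add1n; apply: milnor_deg_ltM => //.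
  by apply: milnor_deg_ltB => //; apply: milnor_deg_ltMz.
Qed.

End Tame.

Lemma morph_expz (K : fieldType) (A : zmodType) (g : K -> A) :
  (forall x y, x != 0 -> y != 0 -> g (x * y) = g x + g y) ->
  forall x (n : int), x != 0 -> g (x ^ n) = g x *~ n.
Proof.
move=> gM x n x0.
have g1 : g 1 = 0 by apply: (addrI (g 1)); rewrite -gM ?oner_neq0// mulr1 addr0.
have gX m : g (x ^+ m) = g x *+ m.
  by elim: m => [|m IH]; rewrite ?expr0// exprS gM ?expf_neq0// IH mulrS.
case: n => m; first exact: gX.
rewrite NegzE -exprnN mulrNz -pmulrn -gX; apply: (addrI (g (x ^+ m.+1))).
by rewrite -gM ?invr_eq0 ?expf_neq0// mulfV ?expf_neq0// g1 subrr.
Qed.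

(** The column with entries [1] and [{res c}] is an eigenvector of every matrix
    [tame w], and the eigenvalue is the specialization of [w] at the uniformizer
    [q]. The first row of this identity is the formula; the second one is needed
    to make the identity multiplicative in [w]. *)
Lemma spec_change (K kappa : fieldType) (v : K -> int) (res : K -> kappa) (p q c : K)
    (hv : discrete_valuation v) (hr : residue_field v res)
    (hp : uniformizer v p) (hq : uniformizer v q) (w : milnorK K) :
  p = q * c ->
  spec hv hr hq w = spec hv hr hp w + residue hv hr hp w * sym1 (res c).
Proof.
move=> pE; have [p0 vp] := hp; have [q0 vq] := hq.
have c0 : c != 0 by apply: contraNneq p0 => c0; rewrite pE c0 mulr0.
have vc : v c = 0.
  by apply: (addrI (v q)); rewrite -(dval_mul hv)// -pE vp vq addr0.
pose x := sym1 (res c).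
suff [-> _] : spec hv hr hq w = spec hv hr hp w + residue hv hr hp w * x /\
    x * spec hv hr hq w = twisted_spec hv hr hp w * x by [].
elim/milnor_ind: w => [|a|y z [hy ty] [hz tz]|y z [hy ty] [hz tz]].
- by rewrite !rmorph1 residue1 /twisted_spec rmorph1 mxE mul0r addr0 mulr1 mul1r.
- have [->|a0] := eqVneq a 0.
    by rewrite sym1_0 !raddf0 /twisted_spec rmorph0 mxE !mul0r mulr0 addr0.
  rewrite !spec_sym1// residue_sym1// twisted_spec_sym1//.
  have lE : sym1 (leading v res q a) = sym1 (leading v res p a) + x *~ v a.
    have a'0 := unit_part_neq0 hp a0.
    have lM : forall y z, y != 0 -> z != 0 -> sym1 (leading v res q (y * z)) =
        sym1 (leading v res q y) + sym1 (leading v res q z).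
      by move=> y z y0 z0; rewrite leadingM// sym1M ?leading_neq0.
    have aE : a = unit_part v p a * p ^ v a by rewrite divfK// expfz_neq0.
    rewrite {1}aE lM ?expfz_neq0// leading_unit ?dval_unit_part//; congr (_ + _).
    rewrite (morph_expz lM)// /leading /unit_part vp expr1z pE.
    by rewrite [q * c]mulrC mulfK.
  split; first by rewrite lE mulrzl.
  rewrite lE mulrDr mulrzAr mulrBl mulrzAl addrC; congr (_ + _).
    by rewrite sym1_sqr sym1N1_central.
  exact: sym1_anticomm.
- split; first by rewrite !rmorphB !raddfB /= hy hz mulrBl opprD addrACA.
  by rewrite rmorphB /= mulrBr ty tz /twisted_spec rmorphB !mxE mulrBl.
- split; last by rewrite rmorphM twisted_specM /= mulrA ty -mulrA tz mulrA.
  by rewrite !rmorphM /= residueM hy mulrDl -!mulrA tz hz mulrDr mulrDl -!mulrA addrA.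
Qed.

Lemma residue_natural (K kappa K' kappa' : fieldType)
    (v : K -> int) (res : K -> kappa) (p : K)
    (v' : K' -> int) (res' : K' -> kappa') (p' : K')
    (hv : discrete_valuation v) (hr : residue_field v res) (hp : uniformizer v p)
    (hv' : discrete_valuation v') (hr' : residue_field v' res')
    (hp' : uniformizer v' p')
    (f : {rmorphism K -> K'}) (g : {rmorphism kappa -> kappa'}) :
  f p = p' -> (forall a, a != 0 -> v' (f a) = v a) ->
  (forall a, valuation_ring v a -> res' (f a) = g (res a)) ->
  forall w, residue hv' hr' hp' (milnor_map f w) = milnor_map g (residue hv hr hp w).
Proof.
move=> fp fv fr w.
suff [_ -> _] : [/\ spec hv' hr' hp' (milnor_map f w) = milnor_map g (spec hv hr hp w),
    residue hv' hr' hp' (milnor_map f w) = milnor_map g (residue hv hr hp w) &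
    twisted_spec hv' hr' hp' (milnor_map f w) = milnor_map g (twisted_spec hv hr hp w)].
  by [].
have fl a : a != 0 -> leading v' res' p' (f a) = g (leading v res p a).
  move=> a0; rewrite /leading -fr; last by right; rewrite dval_unit_part.
  by rewrite /unit_part fv// -fp fmorph_div rmorphXz// unitfE; case: hp.
elim/milnor_ind: w => [|a|y z [sy ry ty] [sz rz tz]|y z [sy ry ty] [sz rz tz]].
- rewrite !rmorph1 !residue1 !raddf0 /twisted_spec !rmorph1 !mxE.
  by split; rewrite ?rmorph1.
- have [->|a0] := eqVneq a 0.
    rewrite sym1_0 /twisted_spec !raddf0 !mxE.
    by split; rewrite ?raddf0.
  have fa0 : f a != 0 by rewrite fmorph_eq0.
  rewrite milnor_map_sym1 !spec_sym1// !residue_sym1// !twisted_spec_sym1// fl// fv//.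
  rewrite rmorphB /= !milnor_map_sym1; split=> //; first by rewrite rmorph_int.
  by rewrite raddfMz /= milnor_map_sym1 rmorphN1.
- have tB (a b : milnorK K) : twisted_spec hv hr hp (a - b) =
    twisted_spec hv hr hp a - twisted_spec hv hr hp b.
    by rewrite /twisted_spec rmorphB !mxE.
  have tB' (a b : milnorK K') : twisted_spec hv' hr' hp' (a - b) =
    twisted_spec hv' hr' hp' a - twisted_spec hv' hr' hp' b.
    by rewrite /twisted_spec rmorphB !mxE.
  by rewrite !raddfB /= tB' tB raddfB /= sy sz ry rz ty tz.
rewrite !rmorphM /= !twisted_specM !residueM !rmorphD /= !rmorphM /=.
by rewrite sy sz ry rz ty tz.
Qed.

(** * Rational functions in one variable *)

Section RatFun.
Variable L : fieldType.
Implicit Types (n d : {poly L}).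

Definition ratf : fieldType := {fraction {poly L}}.
Implicit Types (x y : ratf).

Definition ratf_poly : {rmorphism {poly L} -> ratf} := @FracField.tofrac {poly L}.
Definition ratf_const : {rmorphism L -> ratf} := ratf_poly \o polyC.
Definition ratfX : ratf := ratf_poly 'X.

Lemma ratf_poly_eq0 n : (ratf_poly n == 0) = (n == 0).
Proof. exact: tofrac_eq0. Qed.

Lemma ratfP x : exists n d, d != 0 /\ x = ratf_poly n / ratf_poly d.
Proof.
pose r := repr x; exists (frac r).1, (frac r).2; split; first exact: denom_ratioP.
have d0 : ratf_poly (frac r).2 != 0 by rewrite ratf_poly_eq0 denom_ratioP.
apply: (mulIf d0); rewrite divfK//.
rewrite -[x]reprK -/r /ratf_poly /=; unlock FracField.tofrac.
rewrite -[LHS]FracField.pi_mul; apply/eqmodP; rewrite /= /FracField.mulf.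
rewrite FracField.equivfE /= !numden_Ratio ?mulf_neq0 ?oner_neq0 ?denom_ratioP//.
by rewrite !mulr1 mulrC.
Qed.

Definition ratf_reg x :=
  exists nd : {poly L} * {poly L}, nd.2.[0] != 0 /\ x = ratf_poly nd.1 / ratf_poly nd.2.
Definition ratf_unit x := exists nd : {poly L} * {poly L},
  [/\ nd.1.[0] != 0, nd.2.[0] != 0 & x = ratf_poly nd.1 / ratf_poly nd.2].

Lemma poly_at0_neq0 n : n.[0] != 0 -> n != 0.
Proof. by apply: contraNneq => ->; rewrite horner0. Qed.

Lemma ratf_poly_neq0 n : n.[0] != 0 -> ratf_poly n != 0.
Proof. by move=> /poly_at0_neq0; rewrite ratf_poly_eq0. Qed.

Lemma ratfX_neq0 : ratfX != 0.
Proof. by rewrite ratf_poly_eq0 polyX_eq0. Qed.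

Lemma ratf_fracE n d n' d' : d.[0] != 0 -> d'.[0] != 0 ->
  (ratf_poly n / ratf_poly d == ratf_poly n' / ratf_poly d') = (n * d' == n' * d).
Proof.
move=> d0 d'0; rewrite eqr_div ?ratf_poly_neq0// -!rmorphM.
by rewrite -subr_eq0 -rmorphB ratf_poly_eq0 subr_eq0.
Qed.

Lemma ratf_unit_reg x : ratf_unit x -> ratf_reg x.
Proof. by move=> [nd [_ d0 ->]]; exists nd. Qed.

Lemma ratf_unit_neq0 x : ratf_unit x -> x != 0.
Proof. by move=> [nd [n0 d0 ->]]; rewrite mulf_neq0 ?invr_eq0 ?ratf_poly_neq0. Qed.

Lemma ratf_unit1 : ratf_unit 1.
Proof. by exists (1, 1) => /=; rewrite !hornerC oner_neq0 rmorph1 divr1. Qed.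

Lemma ratf_unitM x y : ratf_unit x -> ratf_unit y -> ratf_unit (x * y).
Proof.
move=> [[n d] /= [n0 d0 ->]] [[n' d'] /= [n'0 d'0 ->]].
exists (n * n', d * d') => /=; rewrite !hornerM !mulf_neq0//.
by rewrite mulf_div !rmorphM.
Qed.

Lemma ratf_unitV x : ratf_unit x -> ratf_unit x^-1.
Proof.
by move=> [[n d] /= [n0 d0 ->]]; exists (d, n); rewrite invf_div.
Qed.

Lemma ratf_regM x y : ratf_reg x -> ratf_reg y -> ratf_reg (x * y).
Proof.
move=> [[n d] /= [d0 ->]] [[n' d'] /= [d'0 ->]].
by exists (n * n', d * d') => /=; rewrite !hornerM !mulf_neq0// mulf_div !rmorphM.
Qed.

Lemma ratf_regD x y : ratf_reg x -> ratf_reg y -> ratf_reg (x + y).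
Proof.
move=> [[n d] /= [d0 ->]] [[n' d'] /= [d'0 ->]].
exists (n * d' + n' * d, d * d') => /=; rewrite !hornerM !mulf_neq0//.
by rewrite addf_div ?ratf_poly_neq0// rmorphD !rmorphM.
Qed.

Lemma ratf_reg_const c : ratf_reg (ratf_const c).
Proof. by exists (c%:P, 1) => /=; rewrite hornerC oner_neq0 rmorph1 divr1. Qed.

Lemma ratf_regX : ratf_reg ratfX.
Proof. by exists ('X, 1) => /=; rewrite hornerC oner_neq0 rmorph1 divr1. Qed.

Lemma ratf_regXn m : ratf_reg (ratfX ^+ m).
Proof.
elim: m => [|m IH]; first by rewrite expr0; apply/ratf_unit_reg/ratf_unit1.
by rewrite exprS; apply: ratf_regM => //; apply: ratf_regX.
Qed.

Lemma poly_monomial_unit n : n != 0 ->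
  exists m q, q.[0] != 0 /\ ratf_poly n = ratfX ^+ m * ratf_poly q.
Proof.
move=> n0; have [m [q]] := multiplicity_XsubC n 0.
rewrite n0 /= /root subr0 => q0 ->; exists m, q; split=> //.
by rewrite rmorphM rmorphXn mulrC.
Qed.

Lemma ratf_decomp x : x != 0 -> exists (m : int) u, ratf_unit u /\ x = ratfX ^ m * u.
Proof.
have [n [d [d0 ->]]] := ratfP x; move=> nd0.
have n0 : n != 0 by apply: contraNneq nd0 => ->; rewrite rmorph0 mul0r.
have [m [q [q0 ->]]] := poly_monomial_unit n0.
have [m' [q' [q'0 ->]]] := poly_monomial_unit d0.
exists (m%:Z - m'%:Z), (ratf_poly q / ratf_poly q'); split; first by exists (q, q').
by rewrite expfzDr ?ratfX_neq0// invfM mulrACA exprnN.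
Qed.

Lemma ratf_reg_decomp x : x != 0 -> ratf_reg x ->
  exists (m : nat) u, ratf_unit u /\ x = ratfX ^+ m * u.
Proof.
move=> x0 [[n d] /= [d0 xE]].
have n0 : n != 0 by apply: contraNneq x0 => n0; rewrite xE n0 rmorph0 mul0r.
have [m [q [q0 qE]]] := poly_monomial_unit n0.
exists m, (ratf_poly q / ratf_poly d); split; first by exists (q, d).
by rewrite xE qE mulrA.
Qed.

(** Uniqueness of the order at the origin: evaluate [n = 'X^m d] at 0. *)
Lemma ratfX_pow_unit (m : int) : ratf_unit (ratfX ^ m) -> m = 0.
Proof.
have h k : ratf_unit (ratfX ^+ k.+1) -> False.
  move=> [[n d] /= [n0 d0 /(congr1 (fun z => z * ratf_poly d))]].
  rewrite divfK ?ratf_poly_neq0// => /eqP.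
  rewrite -rmorphXn -rmorphM -subr_eq0 -rmorphB ratf_poly_eq0 subr_eq0.
  move=> /eqP/(congr1 (fun p => p.[0])); rewrite hornerM hornerXn exprS mul0r mul0r.
  by move=> e; rewrite -e eqxx in n0.
case: m => [[|k]|k] //; first by move/h.
by rewrite NegzE -exprnN => /ratf_unitV; rewrite invrK => /h.
Qed.

(** The order at the origin; by [ratf_decomp] and [ratfX_pow_unit] exactly one
    integer qualifies when [x] is nonzero. *)
Definition ratf_val x : int :=
  xget 0%Z [set m : int | exists u, ratf_unit u /\ x = ratfX ^ m * u]%classic.

Lemma ratf_valE m u : ratf_unit u -> ratf_val (ratfX ^ m * u) = m.
Proof.
move=> uU; rewrite /ratf_val; case: xgetP => [m' _ [u' [u'U]]|/(_ m)]; last first.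
  by case; exists u.
move=> e; apply/eqP; rewrite -subr_eq0; apply/eqP/ratfX_pow_unit.
suff -> : ratfX ^ (m' - m) = u / u'.
  by apply: ratf_unitM => //; apply: ratf_unitV.
have u'0 := ratf_unit_neq0 u'U; apply: (mulIf u'0); rewrite divfK//.
apply: (mulfI (expfz_neq0 m ratfX_neq0)).
by rewrite mulrA -expfzDr ?ratfX_neq0// addrC subrK e.
Qed.

Lemma ratf_val_unit u : ratf_unit u -> ratf_val u = 0.
Proof. by move=> uU; rewrite -[u]mul1r -(expr0z ratfX) ratf_valE. Qed.

Lemma ratf_val_reg x : x != 0 -> ratf_reg x -> 0 <= ratf_val x.
Proof.
by move=> x0 /(ratf_reg_decomp x0)[m [u [uU ->]]]; rewrite (ratf_valE m%:Z).
Qed.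

Lemma ratf_regP x : valuation_ring ratf_val x <-> ratf_reg x.
Proof.
have [->|x0] := eqVneq x 0.
  split=> _; last by left.
  by rewrite -(rmorph0 ratf_const); apply: ratf_reg_const.
split=> [[/eqP|]|]; first by rewrite (negPf x0).
  have [m [u [uU ->]]] := ratf_decomp x0; rewrite ratf_valE//.
  case: m => // m _; apply: ratf_regM; first exact: ratf_regXn.
  exact: ratf_unit_reg.
by move=> /ratf_val_reg; right; auto.
Qed.

Lemma ratf_dval : discrete_valuation ratf_val.
Proof.
have X0 := ratfX_neq0; split.
- move=> x y x0 y0.
  have [m [u [uU ->]]] := ratf_decomp x0; have [k [w [wU ->]]] := ratf_decomp y0.
  rewrite !ratf_valE// mulrACA -expfzDr// ratf_valE//.
  exact: ratf_unitM.
- move=> x y; wlog : x y / ratf_val x <= ratf_val y.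
    move=> wl x0 y0 xy0; case/orP: (le_total (ratf_val x) (ratf_val y)) => xy; first exact: wl.
    by have := wl y x xy y0 x0; rewrite (addrC y x) minC; apply.
  move=> + x0 y0 xy0.
  move: xy0; have [m [u [uU ->]]] := ratf_decomp x0.
  have [k [w [wU ->]]] := ratf_decomp y0.
  rewrite !ratf_valE// => xy0 mk; rewrite min_l//.
  have e : ratfX ^ m * u + ratfX ^ k * w = ratfX ^ m * (u + ratfX ^ (k - m) * w).
    by rewrite mulrDr mulrA -expfzDr// addrC addrC subrKC.
  rewrite e in xy0 *; set z := u + _ in xy0 *.
  have z0 : z != 0 by apply: contraNneq xy0 => ->; rewrite mulr0.
  have zO : ratf_reg z.
    apply: ratf_regD; first exact: ratf_unit_reg.
    apply: ratf_regM; last exact: ratf_unit_reg.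
    move: mk; rewrite -subr_ge0; case: (k - m) => // j _; exact: ratf_regXn.
  have [j [u' [u'U ->]]] := ratf_reg_decomp z0 zO.
  by rewrite mulrA (exprnP _ j) -expfzDr// ratf_valE// lerDl.
- by exists ratfX => //; rewrite -[ratfX]mulr1 -{1}(expr1z ratfX) ratf_valE//; apply: ratf_unit1.
Qed.

Lemma ratf_uniformizer : uniformizer ratf_val ratfX.
Proof.
split; first exact: ratfX_neq0.
by rewrite -[ratfX]mulr1 -{1}(expr1z ratfX) ratf_valE//; apply: ratf_unit1.
Qed.

(** The value at the origin, which [ratf_resE] shows to be independent of the
    fraction. *)
Definition ratf_res x : L :=
  let nd := xget (0, 1) [set nd : {poly L} * {poly L} |
    nd.2.[0] != 0 /\ x = ratf_poly nd.1 / ratf_poly nd.2]%classic in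
  nd.1.[0] / nd.2.[0].

Lemma ratf_resE n d : d.[0] != 0 -> ratf_res (ratf_poly n / ratf_poly d) = n.[0] / d.[0].
Proof.
move=> d0; rewrite /ratf_res; case: xgetP => [[n' d'] _ /= [d'0]|/(_ (n, d))]; last first.
  by case.
move/eqP; rewrite ratf_fracE// => /eqP/(congr1 (fun p => p.[0])).
by rewrite !hornerM => e; apply/eqP; rewrite eqr_div// e.
Qed.

Lemma ratf_residue_field : residue_field ratf_val ratf_res.
Proof.
split.
- have := @ratf_resE 1 1; rewrite !hornerC rmorph1 !divr1; apply; exact: oner_neq0.
- move=> x y /ratf_regP [[n d] /= [d0 ->]] /ratf_regP[[n' d'] /= [d'0 ->]].
  rewrite addf_div ?ratf_poly_neq0// -!rmorphM -rmorphD !ratf_resE//.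
    by rewrite addf_div// hornerD !hornerM.
  by rewrite hornerM mulf_neq0.
- move=> x y /ratf_regP [[n d] /= [d0 ->]] /ratf_regP[[n' d'] /= [d'0 ->]].
  rewrite mulf_div -!rmorphM !ratf_resE//.
    by rewrite mulf_div !hornerM.
  by rewrite hornerM mulf_neq0.
- move=> c; exists (ratf_const c); first by apply/ratf_regP/ratf_reg_const.
  have := @ratf_resE c%:P 1; rewrite !hornerC rmorph1 !divr1; apply; exact: oner_neq0.
move=> x xO; split=> [|[->|vx]].
- move: xO => /ratf_regP [[n d] /= [d0 ->]]; rewrite ratf_resE// => /eqP.
  have [->|x0] := eqVneq (ratf_poly n / ratf_poly d) 0; first by left.
  rewrite mulf_eq0 invr_eq0 (negPf d0) orbF => /eqP nE; right.
  have xO : ratf_reg (ratf_poly n / ratf_poly d) by exists (n, d).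
  rewrite lt_neqAle ratf_val_reg// andbT; apply/negP => /eqP vE.
  have [m [u [uU xE]]] := ratf_decomp x0.
  move: vE; rewrite xE ratf_valE// => m0; move: xE; rewrite -m0 expr0z mul1r => xE.
  move: uU; rewrite -xE => -[[n' d'] /= [n'0 d'0]] /eqP.
  rewrite ratf_fracE// => /eqP/(congr1 (fun p => p.[0])); rewrite !hornerM nE mul0r.
  by move/esym/eqP; rewrite mulf_eq0 (negPf n'0) (negPf d0).
- have := @ratf_resE 0 1; rewrite !hornerC rmorph0 !mul0r; apply; exact: oner_neq0.
have [->|x0] := eqVneq x 0.
  have := @ratf_resE 0 1; rewrite !hornerC rmorph0 !mul0r; apply; exact: oner_neq0.
have [[|m] [u [uU xE]]] := ratf_reg_decomp x0 (proj1 (ratf_regP x) xO).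
  by move: vx; rewrite xE mul1r ratf_val_unit// ltxx.
have [[n d] /= [_ d0 uE]] := uU.
rewrite xE uE mulrA -rmorphXn -rmorphM ratf_resE// hornerM hornerXn.
by rewrite exprS !mul0r.
Qed.

Lemma ratf_val_const c : c != 0 -> ratf_val (ratf_const c) = 0.
Proof.
move=> c0; apply: ratf_val_unit; exists (c%:P, 1) => /=.
by rewrite !hornerC oner_neq0 rmorph1 divr1.
Qed.

Lemma ratf_res_const c : ratf_res (ratf_const c) = c.
Proof.
have := @ratf_resE c%:P 1; rewrite !hornerC rmorph1 !divr1; apply; exact: oner_neq0.
Qed.

Lemma ratf_valuation_ring_const c : valuation_ring ratf_val (ratf_const c).
Proof. exact/ratf_regP/ratf_reg_const. Qed.
End RatFun.

Section RatFunMap.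
Variables (k L : fieldType) (f : {rmorphism k -> L}).

Definition ratf_map_fun (x : ratf k) : ratf L :=
  let nd := xget (0, 1) [set nd : {poly k} * {poly k} |
    nd.2 != 0 /\ x = ratf_poly k nd.1 / ratf_poly k nd.2]%classic in
  ratf_poly L (map_poly f nd.1) / ratf_poly L (map_poly f nd.2).

Lemma ratf_map_funE n d : d != 0 ->
  ratf_map_fun (ratf_poly k n / ratf_poly k d) =
  ratf_poly L (map_poly f n) / ratf_poly L (map_poly f d).
Proof.
move=> d0; rewrite /ratf_map_fun.
case: xgetP => [[n' d'] _ /= [d'0]|/(_ (n, d))]; last by case.
move/eqP; rewrite eqr_div ?ratf_poly_eq0// -!rmorphM -subr_eq0 -rmorphB ratf_poly_eq0.
rewrite subr_eq0 => /eqP/(congr1 (map_poly f)); rewrite !rmorphM /= => e.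
by apply/eqP; rewrite eqr_div ?ratf_poly_eq0 ?map_poly_eq0// -!(rmorphM (ratf_poly L)) e.
Qed.

Fact ratf_map_zmod : zmod_morphism ratf_map_fun.
Proof.
move=> x y; have [n [d [d0 ->]]] := ratfP x; have [n' [d' [d'0 ->]]] := ratfP y.
rewrite -mulNr -rmorphN addf_div ?ratf_poly_eq0// -!rmorphM -rmorphD.
rewrite !ratf_map_funE ?mulf_neq0// -mulNr -rmorphN addf_div ?ratf_poly_eq0 ?map_poly_eq0//.
by rewrite rmorphD !rmorphM !rmorphN /= rmorphD !rmorphM rmorphN.
Qed.

Fact ratf_map_monoid : monoid_morphism ratf_map_fun.
Proof.
split.
  have := @ratf_map_funE 1 1 (oner_neq0 _).
  by rewrite !rmorph1 !divr1.
move=> x y; have [n [d [d0 ->]]] := ratfP x; have [n' [d' [d'0 ->]]] := ratfP y.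
rewrite mulf_div -!rmorphM !ratf_map_funE ?mulf_neq0// mulf_div.
by rewrite !rmorphM.
Qed.

HB.instance Definition _ :=
  GRing.isZmodMorphism.Build (ratf k) (ratf L) ratf_map_fun ratf_map_zmod.
HB.instance Definition _ :=
  GRing.isMonoidMorphism.Build (ratf k) (ratf L) ratf_map_fun ratf_map_monoid.

Definition ratf_map : {rmorphism ratf k -> ratf L} := ratf_map_fun.

Lemma ratf_mapE n d : d != 0 ->
  ratf_map (ratf_poly k n / ratf_poly k d) =
  ratf_poly L (map_poly f n) / ratf_poly L (map_poly f d).
Proof. exact: ratf_map_funE. Qed.

Lemma ratf_map_poly n : ratf_map (ratf_poly k n) = ratf_poly L (map_poly f n).
Proof.
by have := @ratf_mapE n 1 (oner_neq0 _); rewrite !rmorph1 !divr1.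
Qed.

Lemma ratf_map_const c : ratf_map (ratf_const k c) = ratf_const L (f c).
Proof. by rewrite [LHS]ratf_map_poly map_polyC. Qed.

Lemma ratf_mapX : ratf_map (ratfX k) = ratfX L.
Proof. by rewrite [LHS]ratf_map_poly map_polyX. Qed.

Lemma map_poly_at0 (n : {poly k}) : (map_poly f n).[0] = f n.[0].
Proof. by rewrite -(rmorph0 f) horner_map. Qed.

Lemma ratf_val_map x : x != 0 -> ratf_val (ratf_map x) = ratf_val x.
Proof.
move=> x0; have [m [u [uU ->]]] := ratf_decomp x0.
rewrite rmorphM rmorphXz ?unitfE ?ratfX_neq0// ratf_mapX !ratf_valE//.
case: uU => -[n d] /= [n0 d0 ->]; exists (map_poly f n, map_poly f d).
by rewrite !map_poly_at0 !fmorph_eq0 -ratf_mapE// poly_at0_neq0.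
Qed.

Lemma ratf_res_map x : valuation_ring (@ratf_val k) x ->
  ratf_res (ratf_map x) = f (ratf_res x).
Proof.
move=> /ratf_regP[[n d] /= [d0 ->]].
rewrite ratf_mapE ?poly_at0_neq0// !ratf_resE ?map_poly_at0 ?fmorph_eq0//.
by rewrite fmorph_div.
Qed.
End RatFunMap.

(** * The residue at the origin of the line *)

Section TadicResidue.
Variable k : fieldType.
Implicit Types (w : milnorK (ratf k)) (c : milnorK k) (a : k).

Local Notation hv := (ratf_dval k).
Local Notation hr := (ratf_residue_field k).
Local Notation hp := (ratf_uniformizer k).

Definition tres w : milnorK k := residue hv hr hp w.
HB.instance Definition _ := GRing.Additive.copy tres (residue hv hr hp).

Lemma leading_const (p : ratf k) a : leading (@ratf_val k) (@ratf_res k) p (ratf_const k a) = a.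
Proof.
have [->|a0] := eqVneq a 0.
  by rewrite rmorph0 /leading /unit_part mul0r -(rmorph0 (ratf_const k)) ratf_res_const.
by rewrite leading_unit ?ratf_res_const// ratf_val_const.
Qed.

Lemma tspec_const c : spec hv hr hp (milnor_map (ratf_const k) c) = c.
Proof.
elim/milnor_ind: c => [|a|x y hx hy|x y hx hy]; rewrite ?rmorph1//.
- have [->|a0] := eqVneq a 0; first by rewrite sym1_0 !raddf0.
  by rewrite milnor_map_sym1 spec_sym1 ?fmorph_eq0// leading_const.
- by rewrite rmorphB raddfB /= hx hy.
- by rewrite !rmorphM /= hx hy.
Qed.

Lemma tres_sym1_const a : tres (sym1 (ratf_const k a)) = 0.
Proof.
have [->|a0] := eqVneq a 0; first by rewrite rmorph0 sym1_0 raddf0.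
by rewrite /tres residue_sym1 ?fmorph_eq0// ratf_val_const.
Qed.

Lemma twisted_spec_sym1_const a :
  twisted_spec hv hr hp (sym1 (ratf_const k a)) = - sym1 a.
Proof.
have [->|a0] := eqVneq a 0.
  by rewrite rmorph0 !sym1_0 /twisted_spec rmorph0 mxE oppr0.
by rewrite twisted_spec_sym1 ?fmorph_eq0// ratf_val_const// leading_const sub0r.
Qed.

(** A constant symbol anticommutes with the residue, which lowers the degree by
    one. *)
Lemma tresM_const w a : tres (w * sym1 (ratf_const k a)) = - (tres w * sym1 a).
Proof.
rewrite [LHS]residueM -/(tres _) twisted_spec_sym1_const.
by rewrite [X in _ * X]tres_sym1_const mulr0 add0r mulrN.
Qed.

Lemma tres_const c : tres (milnor_map (ratf_const k) c) = 0.
Proof.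
elim/milnor_ind: c => [|a|x y hx hy|x y hx hy].
- by rewrite rmorph1 [LHS]residue1.
- by rewrite milnor_map_sym1 tres_sym1_const.
- by rewrite !raddfB /= hx hy subr0.
- rewrite rmorphM /= [LHS]residueM [X in _ * X + _]hy mulr0 add0r.
  by rewrite [X in X * _]hx mul0r.
Qed.

Lemma tresM_X c : tres (milnor_map (ratf_const k) c * sym1 (ratfX k)) = c.
Proof.
have vX : ratf_val (ratfX k) = 1 by case: hp.
rewrite [LHS]residueM [X in _ + X * _]tres_const mul0r addr0 tspec_const.
by rewrite residue_sym1 ?ratfX_neq0// vX mulr1.
Qed.
End TadicResidue.

Lemma tres_map (k L : fieldType) (f : {rmorphism k -> L}) (w : milnorK (ratf k)) :
  tres (milnor_map (ratf_map f) w) = milnor_map f (tres w).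
Proof.
apply: residue_natural; first exact: ratf_mapX.
  exact: ratf_val_map.
exact: ratf_res_map.
Qed.

Lemma milnor_map_comp (k L M : fieldType) (f : {rmorphism k -> L})
    (g : {rmorphism L -> M}) (h : {rmorphism k -> M}) :
  (forall a, g (f a) = h a) -> forall x, milnor_map g (milnor_map f x) = milnor_map h x.
Proof.
move=> gf; elim/milnor_ind => [|a|x y hx hy|x y hx hy]; rewrite ?rmorph1//.
- by rewrite !milnor_map_sym1 gf.
- by rewrite !raddfB /= hx hy.
- by rewrite !rmorphM /= hx hy.
Qed.

Lemma milnor_map_id (k : fieldType) (f : {rmorphism k -> k}) :
  f =1 id -> forall x, milnor_map f x = x.
Proof.
move=> fid; elim/milnor_ind => [|a|x y hx hy|x y hx hy]; rewrite ?rmorph1//.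
- by rewrite milnor_map_sym1 fid.
- by rewrite raddfB /= hx hy.
- by rewrite rmorphM /= hx hy.
Qed.

(** Generic symbols are not zero divisors: their entries are removed one at a
    time by adjoining a variable and taking its residue. *)
Lemma milnor_generic_inj n (k : fieldType) (y : milnorK k) :
  (forall (L : fieldType) (f : {rmorphism k -> L}) (s : seq L), size s = n ->
    milnor_map f y * symbol s = 0) -> y = 0.
Proof.
elim: n => [|n IH] h.
  by have := h k idfun [::] erefl; rewrite symbol_nil mulr1 milnor_map_id.
apply: IH => L f s sn; pose c := ratf_const L.
have := h (ratf L) (c \o f) (rcons (map c s) (ratfX L)).
rewrite size_rcons size_map sn => /(_ erefl)/(congr1 (@tres L)).
rewrite symbol_rcons mulrA -(@milnor_map_comp _ _ _ f c)//.
by rewrite -milnor_map_symbol -rmorphM /= tresM_X raddf0.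
Qed.

(** * Operations on words *)

Section WordOperations.
Variables (k0 : fieldType).

(** Families of functions of finitely many field elements, compared below along
    the extensions of [k0]. Having all the arities in one object lets an operation
    and its iterated coefficients have the same type. *)
Definition word_op := forall k : fieldType, {rmorphism k0 -> k} -> seq k -> milnorK k.
Implicit Types F : word_op.

Definition word_natural F := forall (k l : fieldType) (iota : {rmorphism k0 -> k})
    (iota' : {rmorphism k0 -> l}) (f : {rmorphism k -> l}),
  (forall a, f (iota a) = iota' a) ->
  forall s, milnor_map f (F k iota s) = F l iota' (map f s).

(** The value is affine in the symbol of each entry when the other entries are
    fixed in a field [k], and the slope is defined over [k]. *)
Definition word_affine F := forall (k : fieldType) (iota : {rmorphism k0 -> k}) (s r : seq k),
  exists c : milnorK k, forall (l : fieldType) (iota' : {rmorphism k0 -> l})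
    (f : {rmorphism k -> l}), (forall a, f (iota a) = iota' a) -> forall a : l,
  F l iota' (map f s ++ a :: map f r) =
  F l iota' (map f s ++ 1 :: map f r) + milnor_map f c * sym1 a.

Definition iota_ratf (k : fieldType) (iota : {rmorphism k0 -> k}) : {rmorphism k0 -> ratf k} :=
  ratf_const k \o iota.

(** The slope in the last entry, computed at a variable: the residue kills the
    constant term and extracts the coefficient of the symbol of the variable. *)
Definition word_der F : word_op := fun k iota s =>
  tres (F (ratf k) (iota_ratf iota) (rcons (map (ratf_const k) s) (ratfX k))).

Lemma iota_ratf_map (k l : fieldType) (iota : {rmorphism k0 -> k})
    (iota' : {rmorphism k0 -> l}) (f : {rmorphism k -> l}) :
  (forall a, f (iota a) = iota' a) ->
  forall a, ratf_map f (iota_ratf iota a) = iota_ratf iota' a.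
Proof. by move=> fi a; rewrite /iota_ratf /= ratf_map_const fi. Qed.

Lemma map_ratf_const (k l : fieldType) (f : {rmorphism k -> l}) (s : seq k) :
  map (ratf_map f) (map (ratf_const k) s) = map (ratf_const l) (map f s).
Proof. by rewrite -!map_comp; apply: eq_map => a /=; apply: ratf_map_const. Qed.

Lemma word_der_natural F : word_natural F -> word_natural (word_der F).
Proof.
move=> nF k l iota iota' f fi s; rewrite /word_der -tres_map.
rewrite (nF _ _ _ (iota_ratf iota') (ratf_map f)); last exact: iota_ratf_map.
by rewrite map_rcons map_ratf_const ratf_mapX.
Qed.

(** The slope in the last entry is again affine in the others: apply the affinity
    over [k(t)], with [t] as last entry, and take the residue at [t = 0]. In this
    way commutation with specialization only has to be used once, for the operation
    itself. *)
Lemma word_der_affine F : word_affine F -> word_affine (word_der F).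
Proof.
move=> aF k iota s r; pose t := ratf_const k.
have [c cP] := aF _ (iota_ratf iota) (map t s) (rcons (map t r) (ratfX k)).
exists (- tres c) => l iota' f fi a; rewrite /word_der.
have E (b : l) : rcons (map (ratf_const l) (map f s ++ b :: map f r)) (ratfX l) =
    map (ratf_map f) (map t s) ++ ratf_const l b :: map (ratf_map f) (rcons (map t r) (ratfX k)).
  rewrite map_cat map_rcons !map_ratf_const /= rcons_cat rcons_cons.
  by rewrite [ratf_map f _]ratf_mapX.
rewrite !E rmorph1 (cP _ (iota_ratf iota')); last exact: iota_ratf_map.
by rewrite raddfD /= tresM_const tres_map raddfN mulNr.
Qed.

Lemma word_der_rcons F : word_natural F -> word_affine F ->
  forall (k : fieldType) (iota : {rmorphism k0 -> k}) s a,
  F k iota (rcons s a) = F k iota (rcons s 1) + word_der F iota s * sym1 a.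
Proof.
move=> nF aF k iota s a; have [c cP] := aF k iota s [::].
have := cP k iota idfun (fun=> erefl) a; rewrite map_id !cats1 milnor_map_id// => ->.
congr (_ + _ * _); rewrite /word_der.
have := cP (ratf k) (iota_ratf iota) (ratf_const k) (fun=> erefl) (ratfX k).
rewrite !cats1 => ->; rewrite raddfD /= tresM_X.
by rewrite -(rmorph1 (ratf_const k)) -map_rcons -(nF _ _ iota) ?tres_const ?add0r.
Qed.
End WordOperations.

(** * Words as sums of symbols *)

Section WordSum.
Variable i : nat.
Hypothesis i_gt0 : (0 < i)%N.

Definition word_sum (k : fieldType) (s : seq k) : milnorK k :=
  \sum_(j < size s %/ i) symbol (take i (drop (j * i) s)).

Lemma size_block (k : fieldType) (s : seq k) (j : nat) :
  (j < size s %/ i)%N -> size (take i (drop (j * i) s)) = i.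
Proof.
move=> js; apply: size_takel; rewrite size_drop leq_subRL.
  by rewrite -mulSnr; apply: leq_trans (leq_divM _ i); rewrite leq_mul2r js orbT.
by apply: leq_trans (leq_divM _ i); rewrite leq_mul2r ltnW ?orbT.
Qed.

Lemma word_sum_deg (k : fieldType) (s : seq k) : word_sum s \in @milnor_deg k i.
Proof.
apply: rpred_sum => j _; apply/asboolP.
have /eqP szb := size_block (ltn_ord j).
by exists [:: (1, Tuple szb)]; rewrite big_seq1 mulr1z.
Qed.

Definition word_sumn (k : fieldType) (s : seq k) : milnorKn k i :=
  Sub (word_sum s) (word_sum_deg s).

Lemma word_sum_cat (k : fieldType) (s r : seq k) :
  (i %| size s)%N -> word_sum (s ++ r) = word_sum s + word_sum r.
Proof.
move=> /dvdnP[m sm]; rewrite /word_sum size_cat sm divnMDl// mulnK//.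
rewrite big_split_ord /=; congr (_ + _); apply: eq_bigr => j _ /=.
  have jm : (j * i + i <= m * i)%N by rewrite -mulSnr leq_mul2r ltn_ord orbT.
  rewrite drop_cat sm ifT; last by apply: leq_trans jm; rewrite -addn1 leq_add2l.
  by rewrite takel_cat// size_drop sm leq_subRL// (leq_trans (leq_addr _ _) jm).
by rewrite mulnDl drop_cat sm ltnNge leq_addr /= addKn.
Qed.

Lemma word_sum_block (k : fieldType) (b : seq k) : size b = i -> word_sum b = symbol b.
Proof. by move=> bi; rewrite /word_sum bi divnn i_gt0 big_ord1 drop0 -bi take_size. Qed.

Lemma word_sum_nil (k : fieldType) : word_sum [::] = 0 :> milnorK k.
Proof. by rewrite /word_sum div0n big_ord0. Qed.

Lemma word_sum_map (k l : fieldType) (g : {rmorphism milnorK k -> milnorK l})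
    (h : k -> l) (s : seq k) :
  (forall a, a \in s -> g (sym1 a) = sym1 (h a)) -> g (word_sum s) = word_sum (map h s).
Proof.
move=> gh; have gs (t : seq k) : {subset t <= s} -> g (symbol t) = symbol (map h t).
  elim: t => [|a t IH] ts; first by rewrite !symbol_nil rmorph1.
  rewrite map_cons !symbol_cons rmorphM gh ?ts ?mem_head// IH// => b bt.
  by apply: ts; rewrite inE bt orbT.
rewrite /word_sum size_map raddf_sum; apply: eq_bigr => j _.
rewrite -map_drop -map_take -gs// => a; by move=> /mem_take/mem_drop.
Qed.

Lemma milnor_map_word_sum (k l : fieldType) (f : {rmorphism k -> l}) (s : seq k) :
  milnor_map f (word_sum s) = word_sum (map f s).
Proof. by apply: word_sum_map => a _; apply: milnor_map_sym1. Qed.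

Lemma word_sum_flatten (k : fieldType) (ss : seq (seq k)) :
  all (fun w => size w == i) ss ->
  (i %| size (flatten ss))%N /\ word_sum (flatten ss) = \sum_(w <- ss) symbol w.
Proof.
elim: ss => [|w ss IH] /=; first by rewrite dvdn0 word_sum_nil big_nil.
move=> /andP[/eqP wi /IH[d e]]; rewrite size_cat wi dvdn_addr// big_cons.
by rewrite word_sum_cat ?wi// word_sum_block// e.
Qed.

Variable k0 : fieldType.
Implicit Types F : word_op k0.

(** The complete blocks at the front of the word enter through the sum of their
    symbols only. The remainder [r] leaves room for the variables that are appended
    when slopes are taken. *)
Definition word_additive F := forall (k : fieldType) (iota : {rmorphism k0 -> k}) s s' r,
  (i %| size s)%N -> (i %| size s')%N -> word_sum s = word_sum s' ->
  F k iota (s ++ r) = F k iota (s' ++ r).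

Lemma word_der_additive F : word_additive F -> word_additive (word_der F).
Proof.
move=> aF k iota s s' r ds ds' ss'; rewrite /word_der !map_cat !rcons_cat.
congr tres; apply: aF; rewrite ?size_map//.
by rewrite -!milnor_map_word_sum ss'.
Qed.

Record word_good F : Prop := {
  word_good_natural : word_natural F;
  word_good_affine : word_affine F;
  word_good_additive : word_additive F
}.

Lemma word_der_good F : word_good F -> word_good (word_der F).
Proof.
by case=> n a r; split;
  [apply: word_der_natural|apply: word_der_affine|apply: word_der_additive].
Qed.

Lemma iter_word_der_good n F : word_good F -> word_good (iter n (@word_der k0) F).
Proof. by move=> gF; elim: n => //= n; apply: word_der_good. Qed.

(** A block containing 1 has symbol 0, so it can be ignored once it is completed;
    if variables are still missing, the residues at them kill the resulting
    constant. *)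
Lemma word_good_degenerate F : word_good F ->
  forall (k : fieldType) (iota : {rmorphism k0 -> k}) s w m,
  (i %| size s)%N -> (size w + m = i)%N -> 1 \in w ->
  iter m (@word_der k0) F k iota (s ++ w) = if m is 0 then F k iota s else 0.
Proof.
move=> gF k iota s w m ds; elim: m k iota s w ds => [|m IH] k iota s w ds wi w1.
  rewrite addn0 in wi.
  rewrite /= -[w]cats0 catA (word_good_additive gF _ (s' := s)) ?cats0//.
    by rewrite size_cat wi dvdn_addr.
  rewrite word_sum_cat// (word_sum_block wi).
  have [p [q wE]] : exists p q, w = p ++ 1 :: q.
    by case/splitPr: w1 => p q; exists p, q.
  by rewrite wE symbol_cat symbol_cons sym1_1 mul0r mulr0 addr0.
rewrite /= /word_der map_cat rcons_cat IH ?size_map//; last first.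
- by rewrite mem_rcons inE -(rmorph1 (ratf_const k)) map_f ?orbT.
- by rewrite size_rcons size_map addSnnS.
case: m {IH wi} => [|m]; last by rewrite raddf0.
by rewrite -(word_good_natural gF (iota := iota))// tres_const.
Qed.

(** The operator extracting the coefficient of a symbol appended to a word. *)
Definition word_diff : word_op k0 -> word_op k0 := iter i (@word_der k0).

Lemma word_diff_good F : word_good F -> word_good (word_diff F).
Proof. exact: iter_word_der_good. Qed.

(** Replace the entries of the last block by 1, beginning with the last one. Each
    step splits off a slope, and all the constant terms vanish by
    [word_good_degenerate] except that of the complete block. *)
Lemma word_good_append F : word_good F ->
  forall (k : fieldType) (iota : {rmorphism k0 -> k}) s b,
  (i %| size s)%N -> size b = i ->
  F k iota (s ++ b) = F k iota s + word_diff F iota s * symbol b.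
Proof.
move=> gF k iota s b ds bi.
suff h m : (size b + m = i)%N -> iter m (@word_der k0) F k iota (s ++ b) =
    (if m is 0 then F k iota s else 0) + word_diff F iota s * symbol b.
  by rewrite -(h 0) ?addn0.
elim/last_ind: b m {bi} => [|b a IH] m bi.
  rewrite cats0 symbol_nil mulr1 /word_diff -[in RHS]bi.
  by case: m bi => [|m] /= bi; [move: i_gt0; rewrite -bi|rewrite add0r].
have gm := iter_word_der_good m gF.
rewrite -rcons_cat word_der_rcons; [|exact: word_good_natural gm|exact: word_good_affine gm].
rewrite rcons_cat (word_good_degenerate gF)//; last first.
- by rewrite mem_rcons mem_head.
- by rewrite size_rcons -(size_rcons b a).
rewrite -[word_der _]/(iter m.+1 (@word_der k0) F) IH; last first.
  by rewrite -addSnnS -(size_rcons b a).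
by rewrite add0r symbol_rcons mulrA.
Qed.

(** Induction on the number of symbols, applied to [F] and to its difference: this
    is the recursion of the elementary symmetric functions. *)
Lemma word_good_expansion F : word_good F ->
  forall (k : fieldType) (iota : {rmorphism k0 -> k}) (ss : seq (seq k)) N,
  all (fun w => size w == i) ss -> (size ss <= N)%N ->
  F k iota (flatten ss) = \sum_(n < N.+1)
    iter n word_diff F k iota [::] * elem_sym n (map (@symbol k) ss).
Proof.
move=> gF k iota ss; elim/last_ind: ss F gF => [|ss b IH] F gF N.
  move=> _ _; rewrite big_ord_recl elem_sym0 mulr1 big1 ?addr0// => n _.
  by rewrite elem_sym_nil mulr0.
rewrite all_rcons size_rcons => /andP[/eqP bi ssi]; case: N => // N ssN.
have [ds _] := word_sum_flatten ssi.
rewrite flatten_rcons word_good_append// (IH F gF N.+1)//; last exact: ltnW.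
rewrite (IH _ (word_diff_good gF) N)// mulr_suml big_ord_recl [RHS]big_ord_recl.
rewrite -addrA !elem_sym0; congr (_ + _); rewrite -big_split; apply: eq_bigr => n _ /=.
by rewrite map_rcons elem_sym_rcons mulrDr mulrA -iterSr.
Qed.

(** Replacing [F] by an iterated difference, let [y] be the coefficient of the
    product of two symbols. Comparing [F] on [{a b, p}] and on [{a, p} + {b, p}]
    gives [y {a, p} {b, p} = 0], that is [y {-1}^(i-1) {a, b, p} = 0], and
    exchanging two symbols of odd length gives [2 y s s' = 0]. The symbols are
    arbitrary, hence may be taken generic and cancelled. *)
Lemma word_good_coef F n : word_good F -> (1 < n)%N ->
  gamma_coef i (iter n word_diff F k0 idfun [::]).
Proof.
move=> gF n1.
have [G gG ->] : exists2 G, word_good G &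
    iter n word_diff F = word_diff (word_diff G).
  case: n n1 => [|[|n]] // _; exists (iter n word_diff F) => //.
  by elim: n => //= n; apply: word_diff_good.
pose y0 := G k0 idfun [::]; pose y1 := word_diff G idfun [::].
set y := word_diff _ _ _.
have gDG := word_diff_good gG; have gDDG := word_diff_good gDG.
have EG (k : fieldType) (f : {rmorphism k0 -> k}) b b' : size b = i -> size b' = i ->
    G k f (b ++ b') = milnor_map f y0 + milnor_map f y1 * (symbol b + symbol b') +
      milnor_map f y * (symbol b * symbol b').
  move=> bi b'i; have := word_good_expansion gG f (ss := [:: b; b']) (N := 2).
  rewrite /= bi b'i eqxx cats0 => -> //.
  rewrite !big_ord_recl big_ord0 /= addr0 elem_sym0 mulr1 elem_sym1 !big_cons big_nil addr0.
  rewrite (elem_sym_size [:: _; _]) !big_cons big_nil mulr1 addrA.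
  rewrite -(word_good_natural gG (iota := idfun) (f := f) (fun=> erefl) [::]).
  rewrite -(word_good_natural gDG (iota := idfun) (f := f) (fun=> erefl) [::]).
  by rewrite -(word_good_natural gDDG (iota := idfun) (f := f) (fun=> erefl) [::]).
have EG1 (k : fieldType) (f : {rmorphism k0 -> k}) b : size b = i ->
    G k f b = milnor_map f y0 + milnor_map f y1 * symbol b.
  move=> bi; have := word_good_append gG f (s := [::]) (dvdn0 i) bi.
  rewrite -(word_good_natural gG (iota := idfun) (f := f) (fun=> erefl) [::]).
  by rewrite -(word_good_natural gDG (iota := idfun) (f := f) (fun=> erefl) [::]).
have wsum2 (k : fieldType) (b b' : seq k) : size b = i -> size b' = i ->
    (i %| size (b ++ b'))%N /\ word_sum (b ++ b') = symbol b + symbol b'.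
  move=> bi b'i; have := @word_sum_flatten k [:: b; b'].
  by rewrite /= bi b'i eqxx cats0 !big_cons big_nil addr0; apply.
split=> [|oi].
  apply: (@milnor_generic_inj i.+1) => L f; case=> [|a [|b p]] // [pi].
    by move: i_gt0; rewrite -pi.
  have [->|a0] := eqVneq a 0; first by rewrite symbol_mem0 ?mem_head// mulr0.
  have [->|b0] := eqVneq b 0; first by rewrite symbol_mem0 ?mulr0// !inE eqxx orbT.
  have [d e] := wsum2 L (a :: p) (b :: p) pi pi.
  have abE : symbol (a * b :: p) = symbol (a :: p) + symbol (b :: p).
    by rewrite !symbol_cons sym1M// mulrDl.
  have d1 : (i %| size ((a * b)%R :: p))%N by rewrite /= pi.
  have := word_good_additive gG f [::] d1 d.
  rewrite !cats0 e word_sum_block// abE => /(_ erefl).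
  rewrite EG// EG1// abE -[LHS]addr0 => /addrI/esym.
  have [m ->] := @symbolM_share L [::] p a b.
  rewrite mulr_signCA => /(congr1 ( *%R ((-1) ^+ m))).
  rewrite signrMK mulr0 mulrA => <-; congr (_ * _).
  by rewrite /tau rmorphM rmorphXn /= milnor_map_sym1 rmorphN1 sym1N1X_central -pi.
apply: (@milnor_generic_inj (i + i)) => L f s si.
have [b [b' [-> bi b'i]]] : exists b b', [/\ s = b ++ b', size b = i & size b' = i].
  exists (take i s), (drop i s); rewrite cat_take_drop size_drop si addnK.
  by rewrite size_takel// si leq_addr.
have [[d e] [d' e']] := (wsum2 L b b' bi b'i, wsum2 L b' b b'i bi).
have := word_good_additive gG f [::] d d'.
rewrite e e' addrC !cats0 => /(_ erefl); rewrite !EG// [symbol b' + _]addrC => /addrI.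
rewrite [symbol b * _]symbol_comm -signr_odd bi b'i oddM oi mulN1r mulrN => yE.
rewrite symbol_cat symbol_comm -signr_odd bi b'i oddM oi mulN1r mulrN raddfMn.
by rewrite mulr2n mulrDl opprD {1}yE addrN.
Qed.
End WordSum.

(** * Operations commuting with specialization are affine in each entry *)

Section OperationWord.
Variables (k0 : fieldType) (i : nat).
Hypothesis i_gt0 : (0 < i)%N.
Variable phi : op_family k0 i.
Hypotheses (phi_op : is_operation phi) (phi_sp : commutes_with_specialization phi).

Definition op_word : word_op k0 := fun k iota s => phi iota (word_sumn i s).

Lemma milnor_mapn_word_sumn (k l : fieldType) (f : {rmorphism k -> l}) (s : seq k) :
  milnor_mapn f (word_sumn i s) = word_sumn i (map f s).
Proof. by apply: val_inj; apply: milnor_map_word_sum. Qed.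

Lemma op_word_natural : word_natural op_word.
Proof.
by move=> k l iota iota' f fi s; rewrite /op_word (phi_op fi) milnor_mapn_word_sumn.
Qed.

Lemma op_word_additive : word_additive i op_word.
Proof.
move=> k iota s s' r ds ds' ss'; congr (phi _ _); apply: val_inj => /=.
by rewrite !word_sum_cat// ss'.
Qed.

Lemma spec_sym1_leading (K kappa : fieldType) (v : K -> int) (res : K -> kappa) (p : K)
    (hv : discrete_valuation v) (hr : residue_field v res) (hp : uniformizer v p) a :
  spec hv hr hp (sym1 a) = sym1 (leading v res p a).
Proof.
have [->|a0] := eqVneq a 0; last exact: spec_sym1.
by rewrite sym1_0 raddf0 /leading /unit_part mul0r (res0 hr) sym1_0.
Qed.

(** The uniformizer [q = t / c] of [k(t)] specializes the variable [t] to [c] and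
    the constants to themselves. *)
Lemma op_word_spec (k : fieldType) (iota : {rmorphism k0 -> k}) (s r : seq k)
    (q : ratf k) (c : k) (hq : uniformizer (@ratf_val k) q) :
  ratfX k = q * ratf_const k c ->
  spec (ratf_dval k) (ratf_residue_field k) hq
    (op_word (iota_ratf iota) (map (ratf_const k) s ++ ratfX k :: map (ratf_const k) r)) =
  op_word iota (s ++ c :: r).
Proof.
move=> qE; have [q0 vq] := hq.
have vX : ratf_val (ratfX k) = 1 by case: (ratf_uniformizer k).
have hsp := spec_is_specialization (ratf_dval k) (ratf_residue_field k) hq.
have ring_const a : valuation_ring (@ratf_val k) (iota_ratf iota a).
  exact: ratf_valuation_ring_const.
have res_const a : iota a = ratf_res (iota_ratf iota a) by rewrite ratf_res_const.
rewrite [LHS](phi_sp (ratf_dval k) ring_const (ratf_residue_field k) res_const hq hsp).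
congr (phi _ _); apply: val_inj => /=.
rewrite (word_sum_map _ (h := leading (@ratf_val k) (@ratf_res k) q)); last first.
  by move=> a _; apply: spec_sym1_leading.
rewrite map_cat /= -!map_comp; congr (word_sum _ (_ ++ _ :: _)).
- by rewrite -[RHS]map_id; apply: eq_map => a /=; apply: leading_const.
- by rewrite /leading /unit_part vX expr1z qE mulrC mulKf// ratf_res_const.
- by rewrite -[RHS]map_id; apply: eq_map => a /=; apply: leading_const.
Qed.

(** The value of the operation at a variable [t] specializes to its value at 1
    for the uniformizer [t], and to its value at [a] for the uniformizer [t / a].
    By [spec_change] the two specializations differ by the residue at [t = 0] times
    [{a}], and this residue is defined over the field of the other entries. *)
Lemma op_word_affine : word_affine op_word.
Proof.
move=> k iota s r.
pose w := op_word (iota_ratf iota) (map (ratf_const k) s ++ ratfX k :: map (ratf_const k) r).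
exists (tres w) => l iota' f fi a.
have [->|a0] := eqVneq a 0.
  rewrite sym1_0 mulr0 addr0; congr (phi _ _); apply: val_inj => /=.
  (* As [{0} = {1}], all the entries 0 of a word may be replaced by 1. *)
  pose h (b : l) := if b == 0 then 1 else b.
  have hE (t : seq l) : word_sum i t = word_sum i (map h t).
    apply: (@word_sum_map _ _ _ idfun) => b _ /=; rewrite /h.
    by case: eqP => // ->; rewrite sym1_0 sym1_1.
  by rewrite hE [RHS]hE !map_cat /= /h eqxx oner_eq0.
have WE : milnor_map (ratf_map f) w = op_word (iota_ratf iota')
    (map (ratf_const l) (map f s) ++ ratfX l :: map (ratf_const l) (map f r)).
  rewrite (op_word_natural (iota_ratf_map fi)) map_cat /= !map_ratf_const.
  by rewrite [ratf_map f _]ratf_mapX.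
have c0 : ratf_const l a != 0 by rewrite fmorph_eq0.
have [X0 vX] := ratf_uniformizer l.
have hq : uniformizer (@ratf_val l) (ratfX l / ratf_const l a).
  split; first exact: mulf_neq0 X0 (invr_neq0 c0).
  rewrite (dval_mul (ratf_dval l) X0 (invr_neq0 c0)) (dvalV (ratf_dval l) c0).
  by rewrite (ratf_val_const a0) vX subr0.
have qE : ratfX l = ratfX l / ratf_const l a * ratf_const l a.
  exact/esym/(divfK c0).
have XE : ratfX l = ratfX l * ratf_const l 1 by rewrite rmorph1 mulr1.
rewrite -(op_word_spec iota' (map f s) (map f r) hq qE).
rewrite -(op_word_spec iota' (map f s) (map f r) (ratf_uniformizer l) XE).
rewrite -WE (spec_change _ _ (ratf_uniformizer l) hq _ qE) ratf_res_const.
by rewrite -tres_map.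
Qed.

Lemma op_word_good : word_good i op_word.
Proof.
by split; [apply: op_word_natural|apply: op_word_affine|apply: op_word_additive].
Qed.
End OperationWord.

(** * Sums of divided powers *)

Section Sums.
Variables (k0 : fieldType) (i : nat).
Hypothesis i_gt0 : (0 < i)%N.

(** Since [i > 0], the opposite of a symbol is a symbol. *)
Lemma symbol_decomp_exists (k : fieldType) (x : milnorKn k i) :
  exists s : seq (i.-tuple k), is_symbol_sum x s.
Proof.
have /asboolP[ss xE] := valP x; suff [s sE] : exists s : seq (i.-tuple k),
    val x = \sum_(a <- s) symbol a by exists s.
rewrite {}xE; elim: ss => [|[z t] ss [s IH]]; first by exists [::]; rewrite !big_nil.
rewrite big_cons {}IH /=.
have inv_tuple : size (word_inv t) == i by rewrite size_word_inv size_tuple.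
have symbol_inv (w : seq k) : (0 < size w)%N -> symbol (word_inv w) = - symbol w.
  by case: w => // a w _; rewrite !symbol_cons sym1V mulNr.
have sum_nseq (u : i.-tuple k) m : \sum_(a <- nseq m u) symbol a = symbol u *+ m.
  by elim: m => [|m IHm]; rewrite ?big_nil// big_cons IHm mulrS.
case: z => n; first by exists (nseq n t ++ s); rewrite big_cat sum_nseq.
exists (nseq n.+1 (Tuple inv_tuple) ++ s); rewrite big_cat sum_nseq /=.
by rewrite symbol_inv ?size_tuple// NegzE mulrNz -pmulrn -mulNrn.
Qed.

Lemma symbol_decompP (k : fieldType) (x : milnorKn k i) :
  is_symbol_sum x (symbol_decomp x).
Proof.
rewrite /symbol_decomp; case: xgetP => [s _ //|h].
by have [s /h] := symbol_decomp_exists x.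
Qed.

Lemma all_size_tuple (k : fieldType) (s : seq (i.-tuple k)) :
  all (fun w => size w == i) (map val s).
Proof. by rewrite all_map; apply/allP => t _ /=; rewrite size_tuple. Qed.

Lemma gamma_coef_map (k : fieldType) (f : {rmorphism k0 -> k}) (y : milnorK k0) :
  gamma_coef i y -> gamma_coef i (milnor_map f y).
Proof.
move=> [ty y2]; split=> [|oi]; last by rewrite -raddfMn /= y2// raddf0.
by rewrite /tau -(rmorphN1 f) -milnor_map_sym1 -rmorphXn -rmorphM /= -/(tau i y) ty raddf0.
Qed.

Lemma op_gammaE (n : nat) (y : milnorK k0) : (1 < n)%N -> gamma_coef i y ->
  forall (k : fieldType) (iota : {rmorphism k0 -> k}) (x : milnorKn k i) (ss : seq (seq k)),
  all (fun w => size w == i) ss -> val x = \sum_(w <- ss) symbol w ->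
  op_gamma n y iota x = milnor_map iota y * elem_sym n (map (@symbol k) ss).
Proof.
move=> n1 yP k iota x ss ssi xE; rewrite /op_gamma.
rewrite -(esym_coef_indep i_gt0 (gamma_coef_map iota yP) n1 (all_size_tuple (symbol_decomp x)) ssi).
  by rewrite -map_comp.
by rewrite -xE big_map; apply/esym/symbol_decompP.
Qed.

(** The upper bound is [maxn N 1] because the terms of index 0 and 1 are always
    present in [op_sum]. *)
Lemma op_sumE (y : nat -> milnorK k0) N : coef_family i y ->
  forall (k : fieldType) (iota : {rmorphism k0 -> k}) (x : milnorKn k i) (ss : seq (seq k)),
  all (fun w => size w == i) ss -> val x = \sum_(w <- ss) symbol w ->
  op_sum y N iota x =
  \sum_(0 <= n < (maxn N 1).+1) milnor_map iota (y n) * elem_sym n (map (@symbol k) ss).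
Proof.
move=> yP k iota x ss ssi xE; rewrite /op_sum /op_const /op_scale /op_id.
rewrite [RHS]big_ltn// [X in _ = _ + X]big_ltn ?ltnS ?leq_max ?orbT// addrA; congr (_ + _ * _ + _).
- by rewrite elem_sym0 mulr1.
- by rewrite elem_sym1 big_map xE.
have -> : \sum_(2 <= n < N.+1) op_gamma n (y n) iota x =
    \sum_(2 <= n < (maxn N 1).+1) op_gamma n (y n) iota x.
  by case: N => [|N]; [rewrite !big_geq | rewrite (maxn_idPl _)].
apply: eq_big_nat => n /andP[n1 _].
by apply: op_gammaE => //; apply: yP.
Qed.

Definition op_decomp (k : fieldType) (x : milnorKn k i) : seq (seq k) :=
  map val (symbol_decomp x).

Lemma op_decompP (k : fieldType) (x : milnorKn k i) :
  val x = \sum_(w <- op_decomp x) symbol w.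
Proof. by rewrite big_map; apply: symbol_decompP. Qed.

Lemma op_decomp_size (k : fieldType) (x : milnorKn k i) :
  all (fun w => size w == i) (op_decomp x).
Proof. exact: all_size_tuple. Qed.

Lemma op_sum_operation (y : nat -> milnorK k0) N :
  coef_family i y -> is_operation (@op_sum k0 i y N).
Proof.
move=> yP k l iota iota' f fi x.
have di := op_decomp_size x; have dE := op_decompP x.
rewrite (op_sumE N yP iota di dE) rmorph_sum.
rewrite (op_sumE N yP iota' (ss := map (map f) (op_decomp x))).
- apply: eq_bigr => n _; rewrite rmorphM rmorph_elem_sym /=.
  rewrite (milnor_map_comp fi) -!map_comp; congr (_ * elem_sym _ _).
  by apply: eq_map => w /=; apply: milnor_map_symbol.
- by rewrite all_map; apply: sub_all di => w /=; rewrite size_map.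
rewrite -[LHS]/(milnor_map f (val x)) dE rmorph_sum [RHS]big_map.
by apply: eq_bigr => w _; apply: milnor_map_symbol.
Qed.

(** A specialization map is only assumed to be additive; being determined by its
    values on symbols, it is the multiplicative map constructed above. *)
Lemma specialization_unique (K kappa : fieldType) (v : K -> int) (res : K -> kappa) (p : K)
    (hv : discrete_valuation v) (hr : residue_field v res) (hp : uniformizer v p)
    (sp : {additive milnorK K -> milnorK kappa}) :
  is_specialization v res p sp -> sp =1 spec hv hr hp.
Proof.
move=> hsp x; have [_ [s [-> _]]] := milnor_deg_ltP x.
rewrite !raddf_sum; apply: eq_bigr => -[z t] _ /=; rewrite !raddfMz /=; congr (_ *~ _).
have [t0|t0] := boolP (0 \in t); first by rewrite symbol_mem0// !raddf0.
have [p0 _] := hp.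
have tE : t = [seq p ^ e.1 * e.2 | e <- [seq (v a, unit_part v p a) | a <- t]].
  rewrite -map_comp -[LHS]map_id; apply: eq_map => a /=.
  by rewrite mulrC divfK// expfz_neq0.
have tU e : e \in [seq (v a, unit_part v p a) | a <- t] -> e.2 != 0 /\ v e.2 = 0.
  case/mapP=> a ta ->; have a0 : a != 0 by apply: contraNneq t0 => <-.
  by rewrite unit_part_neq0// dval_unit_part.
by rewrite tE hsp// [RHS](spec_is_specialization hv hr hp).
Qed.

Lemma spec_symbol (K kappa : fieldType) (v : K -> int) (res : K -> kappa) (p : K)
    (hv : discrete_valuation v) (hr : residue_field v res) (hp : uniformizer v p) t :
  spec hv hr hp (symbol t) = symbol (map (leading v res p) t).
Proof.
elim: t => [|a t IH]; first by rewrite !symbol_nil rmorph1.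
by rewrite map_cons !symbol_cons rmorphM /= IH spec_sym1_leading.
Qed.

Lemma op_sum_specialization (y : nat -> milnorK k0) N :
  coef_family i y -> commutes_with_specialization (@op_sum k0 i y N).
Proof.
move=> yP K iota v hv Oiota kappa res hr iotaK iotaKE p hp sp hsp x.
have spE := specialization_unique hv hr hp hsp.
have di := op_decomp_size x; have dE := op_decompP x.
rewrite spE (op_sumE N yP iota di dE) rmorph_sum.
rewrite (op_sumE N yP iotaK (ss := map (map (leading v res p)) (op_decomp x))).
- apply: eq_bigr => n _; rewrite rmorphM rmorph_elem_sym /= -!map_comp.
  congr (_ * elem_sym _ _); last by apply: eq_map => w /=; apply: spec_symbol.
  elim/milnor_ind: (y n) => [|a|u w hu hw|u w hu hw]; rewrite ?rmorph1//.
  + rewrite !milnor_map_sym1 spec_sym1_leading; congr sym1.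
    have [->|a0] := eqVneq a 0.
      by rewrite !rmorph0 /leading /unit_part mul0r (res0 hr).
    rewrite leading_unit -?iotaKE//.
    have v_ge0 b : b != 0 -> 0 <= v (iota b).
      by move=> b0; case: (Oiota b) => // /eqP; rewrite fmorph_eq0 (negPf b0).
    apply/eqP; rewrite eq_le v_ge0// andbT -oppr_ge0 -(dvalV hv) ?fmorph_eq0//.
    by rewrite -fmorphV v_ge0// invr_eq0.
  + by rewrite !raddfB /= hu hw.
  + by rewrite !rmorphM /= hu hw.
- by rewrite all_map; apply: sub_all di => w /=; rewrite size_map.
rewrite -[LHS]/(sp (val x)) spE dE rmorph_sum [RHS]big_map.
by apply: eq_bigr => w _; apply: spec_symbol.
Qed.

Lemma milnor_deg_lt_map (k l : fieldType) (f : {rmorphism k -> l}) N x :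
  milnor_deg_lt N x -> milnor_deg_lt N (milnor_map f x).
Proof.
case=> s [-> /allP sN]; rewrite raddf_sum big_seq; apply: milnor_deg_lt_sum => p /sN pN.
rewrite raddfMz; apply: milnor_deg_ltMz.
by rewrite /= milnor_map_symbol; apply: milnor_deg_lt_symbol; rewrite size_map.
Qed.

Lemma milnor_deg_lt_esym (k : fieldType) (ss : seq (seq k)) n :
  all (fun w => size w == i) ss ->
  milnor_deg_lt (n * i).+1 (elem_sym n (map (@symbol k) ss)).
Proof.
have d1 m : milnor_deg_lt m.+1 (1 : milnorK k).
  by rewrite -symbol_nil; apply: milnor_deg_lt_symbol.
elim: ss n => [|w ss IH] [|n] /=; rewrite ?elem_sym0 ?elem_sym_nil//.
  by move=> _; apply: milnor_deg_lt0.
move=> /andP[/eqP wi ssi]; rewrite elem_sym_cons; apply: milnor_deg_ltD; first exact: IH.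
rewrite mulSn -addnS; apply: milnor_deg_ltM; last exact: IH.
by apply: milnor_deg_lt_symbol; rewrite wi.
Qed.

Lemma op_sum_bounded (y : nat -> milnorK k0) N :
  coef_family i y -> bounded_degree (@op_sum k0 i y N).
Proof.
move=> yP; have [M yM] : exists M, forall n, (n <= maxn N 1)%N -> milnor_deg_lt M (y n).
  elim: (maxn N 1) => [|m [M IH]].
    by have [M yM] := milnor_deg_ltP (y 0); exists M => -[].
  have [M' yM'] := milnor_deg_ltP (y m.+1); exists (maxn M M') => n.
  rewrite leq_eqVlt => /orP[/eqP->|nm].
    by apply: milnor_deg_ltW yM'; rewrite leq_maxr.
  by apply: (milnor_deg_ltW (leq_maxl _ _)); apply: IH.
exists (M + (maxn N 1 * i).+1)%N => k iota x; apply/milnor_deg_ltE.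
have di := op_decomp_size x.
rewrite (op_sumE N yP iota di (op_decompP x)) big_nat.
apply: milnor_deg_lt_sum => n /= nN; apply: milnor_deg_ltM.
  by apply: (milnor_deg_ltW (leqnSn _)); apply/milnor_deg_lt_map/yM.
apply: milnor_deg_ltW (milnor_deg_lt_esym n di).
by rewrite ltnS leq_mul2r -ltnS nN orbT.
Qed.

(** By induction, the [m]-th coefficient is the first nonzero one. On a sum of [m]
    symbols the later divided powers vanish and the [m]-th one is the product of
    these symbols, which may be taken generic. *)
Lemma op_sum_eq0 (w : nat -> milnorK k0) n : coef_family i w ->
  (forall (k : fieldType) (iota : {rmorphism k0 -> k}) (x : milnorKn k i),
    exists2 N, (n <= N)%N & op_sum w N iota x = 0) ->
  forall m, (m <= n)%N -> w m = 0.
Proof.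
move=> wP w0 m; elim/ltn_ind: m => m IH mn.
apply: (@milnor_generic_inj (m * i)) => L f s sm.
have [ss [ssi ssm sE]] : exists ss : seq (seq L),
    [/\ all (fun u => size u == i) ss, size ss = m & s = flatten ss].
  exists (reshape (nseq m i) s); have sh : size s = sumn (nseq m i).
    by rewrite sumn_nseq mulnC.
  have shE : shape (reshape (nseq m i) s) = nseq m i by rewrite reshapeKl// sh.
  split; last by rewrite reshapeKr// sh.
    apply/allP => u us; have : size u \in nseq m i.
      by rewrite -shE; apply: map_f.
    by rewrite mem_nseq => /andP[].
  by rewrite -(size_map size) -[map _ _]/(shape _) shE size_nseq.
have [_ xE] := word_sum_flatten i_gt0 ssi; rewrite -sE in xE.
have [N nN] := w0 L f (word_sumn i s); rewrite (op_sumE N wP f ssi)//.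
have mN : (m < (maxn N 1).+1)%N.
  by rewrite ltnS leq_max (leq_trans mn nN).
rewrite big_mkord (bigD1 (Ordinal mN))//= big1 ?addr0 => [<-|j jm].
  rewrite -ssm -(size_map (@symbol L)) elem_sym_size big_map sE; congr (_ * _).
  by elim: {ssi ssm sE xE} ss => [|u ss IHs]; rewrite ?big_nil ?symbol_nil// big_cons /= symbol_cat IHs.
have : (j < m)%N || (m < j)%N by rewrite -neq_ltn.
case/orP => jm'; first by rewrite IH ?raddf0 ?mul0r// (leq_trans (ltnW jm')).
by rewrite elem_sym_gt ?mulr0// size_map ssm.
Qed.

(** * The coefficients of an operation *)

Section Coefficients.
Variable phi : op_family k0 i.
Hypotheses (phi_op : is_operation phi) (phi_sp : commutes_with_specialization phi).

(** The empty word stands for the element 0. *)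
Definition op_coef n : milnorK k0 :=
  iter n (@word_diff i k0) (op_word phi) k0 idfun [::].

Let phi_good := op_word_good i_gt0 phi_op phi_sp.

Lemma iter_word_diff_good n : word_good i (iter n (@word_diff i k0) (op_word phi)).
Proof. by elim: n => //= n; apply: word_diff_good. Qed.

Lemma op_coef_family : coef_family i op_coef.
Proof. by move=> n n1; apply: word_good_coef. Qed.

Lemma op_coef_sum (k : fieldType) (iota : {rmorphism k0 -> k}) (x : milnorKn k i) N :
  (size (op_decomp x) <= N)%N -> phi iota x = op_sum op_coef N iota x.
Proof.
move=> sN; have di := op_decomp_size x; have dE := op_decompP x.
rewrite (op_sumE N op_coef_family iota di dE).
move: (op_decomp x) sN di dE => ss sN di dE.
have -> : x = word_sumn i (flatten ss).
  by apply: val_inj => /=; rewrite (word_sum_flatten i_gt0 di).2.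
rewrite [LHS](word_good_expansion i_gt0 phi_good iota di (N := maxn N 1)).
  rewrite big_mkord; apply: eq_bigr => n _; congr (_ * _).
  by rewrite (word_good_natural (iter_word_diff_good n) (iota' := iota)).
by rewrite leq_max sN.
Qed.

Lemma op_coef_sums_to : op_sums_to op_coef phi.
Proof.
by move=> k iota x; exists (size (op_decomp x)) => N; apply: op_coef_sum.
Qed.

(** Every residue lowers the degree, so the coefficients vanish beyond the bound
    on the degree of the values. *)
Lemma op_coef_bounded : bounded_degree phi ->
  exists N, forall (k : fieldType) (iota : {rmorphism k0 -> k}) (x : milnorKn k i),
  phi iota x = op_sum op_coef N iota x.
Proof.
case=> N phiN; pose bdd M (F : word_op k0) :=
  forall (k : fieldType) (iota : {rmorphism k0 -> k}) s, milnor_deg_lt M (F k iota s).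
have bdd_der M F : bdd M F -> bdd M.-1 (word_der F).
  move=> bF k iota s; apply: residue_deg_lt.
  by apply: milnor_deg_ltW (bF _ _ _); case: M {bF}.
have bdd_W M F : bdd M.-1 F -> bdd M F.
  by move=> bF k iota s; apply: milnor_deg_ltW (leq_pred _) (bF _ _ _).
have bdd_diff M F : bdd M F -> bdd M.-1 (word_diff i F).
  move=> bF; rewrite /word_diff; case: i i_gt0 => // j _ /=.
  by apply: (bdd_der); elim: j => //= j /bdd_der/bdd_W.
have bdd_iter n : bdd (N - n)%N (iter n (@word_diff i k0) (op_word phi)).
  elim: n => [|n IH] /=; last by rewrite subnS; apply: bdd_diff.
  by rewrite subn0 => k iota s; apply/milnor_deg_ltE; apply: phiN.
have y0 n : (N <= n)%N -> op_coef n = 0.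
  rewrite -subn_eq0 => /eqP nN; have := bdd_iter n k0 idfun [::].
  by rewrite nN /op_coef => -[[|p s] [-> //]]; rewrite big_nil.
exists N => k iota x; set M := maxn N (size (op_decomp x)).
rewrite (@op_coef_sum _ _ _ M) ?leq_maxr//.
have di := op_decomp_size x; have dE := op_decompP x.
rewrite !(op_sumE _ op_coef_family iota di dE).
rewrite [LHS](big_cat_nat (n := (maxn N 1).+1))//=.
  rewrite [X in _ + X]big_nat [X in _ + X]big1 ?addr0// => n /andP[nN _].
  rewrite y0 ?raddf0 ?mul0r//; apply: leq_trans (ltnW nN); exact: leq_maxl.
by rewrite ltnS geq_max !leq_max leqnn orbT.
Qed.
End Coefficients.
End Sums.

Unset Implicit Arguments.

Theorem proposition3p19 (k0 : fieldType) (i : nat) (hi : (2 <= i)%N) :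
  [/\ (* y . gamma_n does not depend on the decomposition into symbols *)
      (forall (n : nat) (y : milnorK k0), (2 <= n)%N -> gamma_coef i y ->
        forall (k : fieldType) (iota : {rmorphism k0 -> k}) (x : milnorKn k i)
          (s : seq (i.-tuple k)), is_symbol_sum x s ->
        op_gamma n y iota x
          = milnor_map iota y * elem_sym n [seq symbol a | a : i.-tuple k <- s]),
      (* the operations of bounded degree are the elements of the sum ... *)
      (forall phi : op_family k0 i,
        [/\ is_operation phi, commutes_with_specialization phi & bounded_degree phi]
        <->
        exists (y : nat -> milnorK k0) (N : nat), coef_family i y /\
          forall (k : fieldType) (iota : {rmorphism k0 -> k}) (x : milnorKn k i),
            phi k iota x = op_sum y N iota x),
      (* ... which is direct *)
      (forall (y : nat -> milnorK k0) (N : nat), (1 <= N)%N -> coef_family i y ->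
        (forall (k : fieldType) (iota : {rmorphism k0 -> k}) (x : milnorKn k i),
          op_sum y N iota x = 0) ->
        forall n, (n <= N)%N -> y n = 0),
      (* all operations, without bound on the degree *)
      (forall phi : op_family k0 i,
        is_operation phi /\ commutes_with_specialization phi
        <->
        exists y : nat -> milnorK k0, coef_family i y /\ op_sums_to y phi)
    & (forall (phi : op_family k0 i) (y z : nat -> milnorK k0),
        coef_family i y -> coef_family i z ->
        op_sums_to y phi -> op_sums_to z phi -> forall n, y n = z n)].
Proof.
have i_gt0 : (0 < i)%N by apply: ltnW.
split.
- move=> n y n1 yP k iota x s xs.
  rewrite (op_gammaE i_gt0 n1 yP iota (all_size_tuple s)) -?map_comp//.
  by rewrite big_map; apply: xs.
- move=> phi; split=> [[phi_op phi_sp phi_b]|[y [N [yP phiE]]]].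
    have [N phiN] := op_coef_bounded i_gt0 phi_op phi_sp phi_b.
    by exists (op_coef phi), N; split=> //; apply: op_coef_family.
  split.
  + by move=> k l iota iota' f fi x; rewrite !phiE; apply: op_sum_operation.
  + move=> K iota v hv Oi kappa res hr iotaK iK p hp sp hsp x; rewrite !phiE.
    exact: op_sum_specialization.
  + have [M bM] := op_sum_bounded i_gt0 N yP; exists M => k iota x.
    by rewrite phiE.
- move=> y N N1 yP y0; apply: (op_sum_eq0 i_gt0 yP) => k iota x.
  by exists N.
- move=> phi; split=> [[phi_op phi_sp]|[y [yP phiE]]].
    exists (op_coef phi); split; first exact: op_coef_family.
    exact: op_coef_sums_to.
  split.
  + move=> k l iota iota' f fi x.
    have [N1 e1] := phiE k iota x; have [N2 e2] := phiE l iota' (milnor_mapn f x).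
    rewrite (e1 (maxn N1 N2)) ?leq_maxl// (e2 (maxn N1 N2)) ?leq_maxr//.
    exact: op_sum_operation.
  + move=> K iota v hv Oi kappa res hr iotaK iK p hp sp hsp x.
    have [N1 e1] := phiE K iota x.
    have [N2 e2] := phiE kappa iotaK (specializationn hv hp hsp x).
    rewrite (e1 (maxn N1 N2)) ?leq_maxl// (e2 (maxn N1 N2)) ?leq_maxr//.
    exact: op_sum_specialization.
- move=> phi y z yP zP yphi zphi n.
  pose w m := y m - z m.
  have wP : coef_family i w.
    move=> m m2; have [[ty y2] [tz z2]] := (yP m m2, zP m m2); split.
      by move: ty tz; rewrite /tau mulrBr => -> ->; rewrite subr0.
    by move=> oi; rewrite mulrnBl y2// z2// subr0.
  apply/eqP; rewrite -subr_eq0; apply/eqP.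
  apply: (op_sum_eq0 i_gt0 wP (n := n)) => // k iota x.
  have [N1 e1] := yphi k iota x; have [N2 e2] := zphi k iota x.
  pose N := maxn n (maxn N1 N2); exists N; first exact: leq_maxl.
  have di := op_decomp_size x; have dE := op_decompP i_gt0 x.
  suff -> : op_sum w N iota x = op_sum y N iota x - op_sum z N iota x.
    by rewrite -e1 -?e2 ?subrr// !leq_max leqnn !orbT.
  rewrite (op_sumE i_gt0 N wP iota di dE) (op_sumE i_gt0 N yP iota di dE).
  rewrite (op_sumE i_gt0 N zP iota di dE) -sumrB; apply: eq_bigr => m _.
  by rewrite raddfB mulrBl.
Qed.
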